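(* Suppose $i:Z\hookrightarrow\mathbb{P}^2_{\mathbb{C}}$ embeds $Z$ as a smooth plane curve of degree $n\geq 4$, and let $\gamma:Z\to Z$ be an automorphism. Then there exists a projective change of coordinates $\psi:\mathbb{P}^2_{\mathbb{C}}\to\mathbb{P}^2_{\mathbb{C}}$ such that $\psi\circ i=i\circ\gamma$.
   Context: Everything is over $\mathbb{C}$; automorphisms of $Z$ are automorphisms of $Z$ as an algebraic curve over $\mathbb{C}$. A projective change of coordinates is a map of $\mathbb{P}^2_{\mathbb{C}}$ induced by an element of $\operatorname{GL}(3,\mathbb{C})$. *)

(* Defs.v *)
From HB Require Import structures.
From mathcomp Require Import all_boot all_order all_algebra.
From mathcomp Require Import mpoly complex.
From mathcomp Require Import boolp classical_sets reals topology.

Set Implicit Arguments.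
Unset Strict Implicit.
Unset Printing Implicit Defensive.

Import GRing.Theory.

Local Open Scope classical_set_scope.
Local Open Scope ring_scope.

(* Spaces with functions: a topological space with a sheaf of K-algebras of
   K-valued functions such that the non-vanishing locus of a regular function
   is open and its inverse is regular there.  Over an algebraically closed
   field K, classical varieties are particular spaces with functions, and their
   morphisms are exactly the morphisms of spaces with functions.
   A function on U is represented by a total function, [regular U f] depending
   only on the values of f on U (by [regular_local]). *)
HB.mixin Record hasRegular (K : fieldType) (T : Type) & Topological T := {
  regular : set T -> set (T -> K);
  regular_sub : forall (U V : set T) (f : T -> K),
    open U -> open V -> V `<=` U -> regular U f -> regular V f;
  regular_local : forall (U : set T) (f : T -> K), open U ->
    (forall x, U x -> exists V : set T, exists g : T -> K,
       [/\ open V, V x, V `<=` U, regular V g & forall y, V y -> f y = g y]) ->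
    regular U f;
  regular_cst : forall (U : set T) (c : K), open U -> regular U (fun=> c);
  regularD : forall (U : set T) (f g : T -> K), open U ->
    regular U f -> regular U g -> regular U (fun x => f x + g x);
  regularM : forall (U : set T) (f g : T -> K), open U ->
    regular U f -> regular U g -> regular U (fun x => f x * g x);
  regularV : forall (U : set T) (f : T -> K), open U -> regular U f ->
    open (U `&` [set x | f x != 0]) /\
    regular (U `&` [set x | f x != 0]) (fun x => (f x)^-1)
}.

#[short(type="funSpaceType")]
HB.structure Definition FunSpace (K : fieldType) :=
  {T of Topological T & hasRegular K T}.

Section Morphisms.
Variables (K : fieldType).

Definition is_morphism (X Y : funSpaceType K) (phi : X -> Y) : Prop :=
  continuous phi /\
  forall (V : set Y) (f : Y -> K), open V -> regular V f ->
    regular (phi @^-1` V) (f \o phi).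

Definition is_automorphism (X : funSpaceType K) (phi : X -> X) : Prop :=
  is_morphism phi /\
  exists psi : X -> X, [/\ is_morphism psi, cancel phi psi & cancel psi phi].

(* A homeomorphism onto a closed subset such that O_Y -> phi_* O_X is
   surjective (as a map of sheaves). *)
Definition is_closed_immersion (X Y : funSpaceType K) (phi : X -> Y) : Prop :=
  [/\ is_morphism phi, injective phi,
      forall A : set X, closed A -> closed (phi @` A) &
      forall (U : set X) (f : X -> K) (x : X), open U -> regular U f -> U x ->
        exists V : set Y, exists g : Y -> K,
          [/\ open V, V (phi x), phi @^-1` V `<=` U, regular V g &
              forall y, V (phi y) -> f y = g (phi y)]].

End Morphisms.

Definition mpeval (K : fieldType) (n : nat) (G : {mpoly K[n]}) (v : 'cV[K]_n) : K :=
  G.@[fun j => v j 0].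

(* The points of P^n are the lines through the origin of K^(n+1). *)
Definition proj_space (K : fieldType) (n : nat) : Type :=
  {L : {vspace 'cV[K]_n.+1} | \dim L == 1%N}.

HB.instance Definition _ (K : fieldType) (n : nat) :=
  Choice.on (proj_space K n).

Section ProjectiveSpace.
Variables (K : fieldType) (n : nat).
Local Notation P := (proj_space K n).
Local Notation form := {mpoly K[n.+1]}.

Definition vanishes_at (G : form) (p : P) : Prop :=
  forall v, v \in val p -> mpeval G v = 0.

Definition zero_locus (S : set form) : set P :=
  [set p | forall G, S G -> vanishes_at G p].

(* The Zariski topology: the closed sets are the zero loci of sets of
   homogeneous polynomials, of possibly different degrees. *)
Definition zariski_open (U : set P) : Prop :=
  exists S : set form,
    (forall G, S G -> exists d, G \is d.-homog) /\ U = ~` zero_locus S.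

Lemma proj_vec (p : P) : exists2 v, v \in val p & v != 0.
Proof.
exists (vpick (val p)); first exact: memv_pick.
rewrite vpick0 -dimv_eq0; by case: p => L /= /eqP ->.
Qed.

Lemma proj_line (p : P) v w : v \in val p -> w \in val p -> v != 0 ->
  exists c : K, w = c *: v.
Proof.
move=> vp wp v0; suff Lv : val p = <[v]>%VS.
  by move: wp; rewrite Lv => /vlineP.
apply/esym/eqP; rewrite eqEdim -memvE vp /= dim_vline v0.
by case: p {vp wp} => L /= /eqP ->.
Qed.

Lemma mpevalZ d (G : form) c v : G \is d.-homog ->
  mpeval G (c *: v) = c ^+ d * mpeval G v.
Proof.
move=> hG; rewrite /mpeval !mevalE mulr_sumr big_seq [RHS]big_seq.
apply: eq_bigr => m mG; rewrite mulrCA; congr (_ * _).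
under eq_bigr do rewrite mxE exprMn.
rewrite big_split /= prodrXr; congr (_ ^+ _ * _).
by rewrite -mdegE (dhomog_mf hG mG).
Qed.

Lemma nvanishP (G : form) d (p : P) : G \is d.-homog ->
  (~ vanishes_at G p) <-> (forall v, v \in val p -> v != 0 -> mpeval G v != 0).
Proof.
move=> hG; split=> [nG v vp v0|nz nG].
  apply/eqP => Gv; apply: nG => w wp.
  by have [c ->] := proj_line vp wp v0; rewrite (mpevalZ _ _ hG) Gv mulr0.
by have [v vp v0] := proj_vec p; have := nz v vp v0; rewrite nG // eqxx.
Qed.

Lemma zariski_openP (U : set P) : zariski_open U <->
  (forall p, U p -> exists d, exists G : form, [/\ G \is d.-homog,
     ~ vanishes_at G p & forall q, ~ vanishes_at G q -> U q]).
Proof.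
split=> [[S [hS ->]] p /existsNP[G /not_implyP[SG nG]]|H].
  have [d hG] := hS _ SG; exists d, G; split=> // q nq.
  by apply/existsNP; exists G; apply/not_implyP.
exists [set G | (exists d, G \is d.-homog) /\
                forall q, ~ vanishes_at G q -> U q].
split=> [G []//|]; apply/seteqP; split=> p /=.
  move=> /H[d [G [hG nG HG]]] /(_ G) /=.
  by apply: contra_not nG; apply; split=> //; exists d.
by move=> /existsNP[G /not_implyP[[_ HG] nG]]; apply: HG.
Qed.

Lemma zariski_openT : zariski_open setT.
Proof.
apply/zariski_openP => p _; exists 0%N, 1; split=> //; first exact: dhomog1.
have [v vp _] := proj_vec p; move=> /(_ v vp) /eqP.
by rewrite /mpeval meval1 oner_eq0.
Qed.

Lemma nvanishM (G H : form) d e p : G \is d.-homog -> H \is e.-homog ->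
  ~ vanishes_at (G * H) p <-> ~ vanishes_at G p /\ ~ vanishes_at H p.
Proof.
move=> hG hH; split=> [nGH|[]].
  by split=> nz; apply: nGH => v vp; rewrite /mpeval mevalM;
    have := nz v vp; rewrite /mpeval => ->; rewrite ?mul0r ?mulr0.
move=> /(nvanishP _ hG) nG /(nvanishP _ hH) nH.
apply/(nvanishP _ (dhomogM hG hH)) => v vp v0.
by rewrite /mpeval mevalM mulf_neq0 // ?(nG v) ?(nH v).
Qed.

Lemma zariski_openI : setI_closed zariski_open.
Proof.
move=> U V /zariski_openP HU /zariski_openP HV; apply/zariski_openP => p [Up Vp].
have [d [G [hG nG GU]]] := HU p Up; have [e [H [hH nH HV']]] := HV p Vp.
exists (d + e)%N, (G * H); split; first exact: dhomogM.
  exact/(nvanishM _ hG hH).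
by move=> q /(nvanishM _ hG hH)[nGq nHq]; split; [apply: GU|apply: HV'].
Qed.

Lemma zariski_open_bigU (I : Type) (f : I -> set P) :
  (forall i, zariski_open (f i)) -> zariski_open (\bigcup_i f i).
Proof.
move=> H; apply/zariski_openP => p [i _ /((zariski_openP _).1 (H i))].
move=> [d [G [hG nG HG]]]; exists d, G; split=> // q /HG; by exists i.
Qed.

End ProjectiveSpace.

HB.instance Definition _ (K : fieldType) (n : nat) :=
  isOpenTopological.Build (proj_space K n) (@zariski_openT K n)
    (@zariski_openI K n) (@zariski_open_bigU K n).

Section ProjectiveRegular.
Variables (K : fieldType) (n : nat).
Local Notation P := (proj_space K n).
Local Notation form := {mpoly K[n.+1]}.

(* Near each point of U, f is the quotient of two homogeneous polynomials of
   the same degree. *)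
Definition proj_regular (U : set P) : set (P -> K) :=
  [set f | forall p, U p ->
     exists d : nat, exists G : form, exists H : form, exists W : set P,
       [/\ G \is d.-homog, H \is d.-homog, open W, W p & W `<=` U] /\
       forall q v, W q -> v \in val q -> v != 0 ->
         mpeval H v != 0 /\ f q = mpeval G v / mpeval H v].

Lemma proj_regular_sub (U V : set P) (f : P -> K) :
  open U -> open V -> V `<=` U -> proj_regular U f -> proj_regular V f.
Proof.
move=> oU oV VU fU p Vp.
have [d [G [H [W [[hG hH oW Wp WU] fW]]]]] := fU p (VU _ Vp).
exists d, G, H, (W `&` V); split; first by split=> //; exact: openI.
by move=> q v [Wq _]; apply: fW.
Qed.

Lemma proj_regular_local (U : set P) (f : P -> K) : open U ->
  (forall x, U x -> exists V : set P, exists g : P -> K,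
     [/\ open V, V x, V `<=` U, proj_regular V g & forall y, V y -> f y = g y]) ->
  proj_regular U f.
Proof.
move=> oU HU p /HU[V [g [oV Vp VU gV fg]]].
have [d [G [H [W [[hG hH oW Wp WV] gW]]]]] := gV p Vp.
exists d, G, H, W; split; first by split=> //; exact: subset_trans WV VU.
by move=> q v Wq vq v0; have Vq := WV q Wq; rewrite (fg _ Vq); exact: gW.
Qed.

Lemma proj_regular_cst (U : set P) (c : K) : open U -> proj_regular U (fun=> c).
Proof.
move=> oU p Up; exists 0%N, c%:MP, 1, U; split.
  by split=> //; [rewrite -[_%:MP]mulr1 mul_mpolyC rpredZ ?dhomog1|exact: dhomog1].
by move=> q v _ _ _; rewrite /mpeval meval1 mevalC oner_neq0 divr1.
Qed.

Lemma proj_regularD (U : set P) (f g : P -> K) : open U ->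
  proj_regular U f -> proj_regular U g -> proj_regular U (fun x => f x + g x).
Proof.
move=> oU fU gU p Up.
have [d [G [H [W [[hG hH oW Wp WU] fW]]]]] := fU p Up.
have [e [G' [H' [W' [[hG' hH' oW' Wp' WU'] gW]]]]] := gU p Up.
exists (d + e)%N, (G * H' + G' * H), (H * H'), (W `&` W'); split.
  split=> //; [|exact: dhomogM|exact: openI|by move=> q [/WU]].
  by apply: rpredD; [|rewrite addnC]; exact: dhomogM.
move=> q v [Wq Wq'] vq v0.
have [H0 ->] := fW q v Wq vq v0; have [H0' ->] := gW q v Wq' vq v0.
by rewrite /mpeval mevalD !mevalM; split; [rewrite mulf_neq0|rewrite addf_div].
Qed.

Lemma proj_regularM (U : set P) (f g : P -> K) : open U ->
  proj_regular U f -> proj_regular U g -> proj_regular U (fun x => f x * g x).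
Proof.
move=> oU fU gU p Up.
have [d [G [H [W [[hG hH oW Wp WU] fW]]]]] := fU p Up.
have [e [G' [H' [W' [[hG' hH' oW' Wp' WU'] gW]]]]] := gU p Up.
exists (d + e)%N, (G * G'), (H * H'), (W `&` W'); split.
  by split=> //; [exact: dhomogM|exact: dhomogM|exact: openI|move=> q [/WU]].
move=> q v [Wq Wq'] vq v0.
have [H0 ->] := fW q v Wq vq v0; have [H0' ->] := gW q v Wq' vq v0.
by rewrite /mpeval !mevalM mulf_neq0 // mulf_div.
Qed.

Lemma proj_regularV (U : set P) (f : P -> K) : open U -> proj_regular U f ->
  open (U `&` [set x | f x != 0]) /\
  proj_regular (U `&` [set x | f x != 0]) (fun x => (f x)^-1).
Proof.
move=> oU fU.
have key p : U p -> f p != 0 ->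
  exists d, exists G : form, exists H : form, exists W : set P,
    [/\ G \is d.-homog, H \is d.-homog, open W, W p &
        W `<=` U `&` [set x | f x != 0]] /\
    forall q v, W q -> v \in val q -> v != 0 ->
      mpeval G v != 0 /\ f q = mpeval G v / mpeval H v.
  move=> Up fp; have [d [G [H [W [[hG hH oW Wp WU] fW]]]]] := fU p Up.
  have GfE q : W q -> ~ vanishes_at G q <-> f q != 0.
    move=> Wq; split=> [/(nvanishP _ hG) nG|fq].
      have [v vq v0] := proj_vec q; have [H0 ->] := fW q v Wq vq v0.
      by rewrite mulf_neq0 ?invr_eq0 ?nG.
    apply/(nvanishP _ hG) => v vq v0; have [H0] := fW q v Wq vq v0.
    by move=> fE; apply: contra_neq fq => G0; rewrite fE G0 mul0r.
  exists d, G, H, (W `&` [set q | ~ vanishes_at G q]); split.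
    split=> //.
    - apply: openI => //; change (zariski_open [set q | ~ vanishes_at G q]).
      apply/zariski_openP => q nq; by exists d, G.
    - by split=> //; apply/GfE.
    - by move=> q [Wq nq]; split; [exact: WU|exact/GfE].
  move=> q v [Wq /(nvanishP _ hG) nG] vq v0; have [H0 fE] := fW q v Wq vq v0.
  by rewrite fE nG.
split.
  rewrite openE => p [Up fp]; have [d [G [H [W [[_ _ oW Wp WU] _]]]]] := key p Up fp.
  by exists W.
move=> p [Up fp]; have [d [G [H [W [[hG hH oW Wp WU] fW]]]]] := key p Up fp.
exists d, H, G, W; split=> // q v Wq vq v0; have [G0 ->] := fW q v Wq vq v0.
by rewrite invf_div.
Qed.

End ProjectiveRegular.

HB.instance Definition _ (K : fieldType) (n : nat) :=
  hasRegular.Build K (proj_space K n) (@proj_regular_sub K n)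
    (@proj_regular_local K n) (@proj_regular_cst K n) (@proj_regularD K n)
    (@proj_regularM K n) (@proj_regularV K n).

Section PlaneCurves.
Variable K : fieldType.
Local Notation P2 := (proj_space K 2).

(* For K algebraically closed, F is then a reduced equation of C by the Jacobian
   criterion, so that no scheme structure has to be recorded. *)
Definition smooth_plane_curve (n : nat) (C : set P2) : Prop :=
  exists F : {mpoly K[3]},
    [/\ F != 0, F \is n.-homog,
        forall v : 'cV[K]_3, v != 0 -> mpeval F v = 0 ->
          exists j : 'I_3, mpeval F^`M(j) v != 0 &
        C = [set p | vanishes_at F p]].

Definition embeds_as_smooth_plane_curve (n : nat) (Z : funSpaceType K)
    (i : Z -> P2) : Prop :=
  is_closed_immersion i /\ smooth_plane_curve n (range i).

Definition is_proj_change (psi : P2 -> P2) : Prop :=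
  exists2 g : 'M[K]_3, g \in unitmx &
    forall p, val (psi p) = (linfun (mulmx g) @: val p)%VS.

End PlaneCurves.

(* Main.v *)
(* Let D be the preimage under gamma of a transversal line section L of the curve
   C : F = 0.  For a linear form L1 vanishing at one point of that section, the
   function L1 / L pulled back by gamma has simple poles at the remaining n - 1
   points of D.  Multiplied by the product E of the r distinct lines joining one
   of these points to the n - 2 others, it is a regular section of O(r) on C, hence
   the restriction of a form B of degree r.  If r >= 2, then on each of these lines
   B has more than r zeros, so B is a constant multiple of E and L1 / L is constant,
   which is absurd.  So r = 1, and as n >= 4 this makes D a line section, cut out by
   some linear form l.  Finally l.(X / L)(gamma), for the coordinates X, are regular
   sections of O(1), i.e. linear forms: they are the rows of the matrix inducing
   gamma. *)
Require Import Defs.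
From mathcomp Require Import all_boot all_order all_algebra.
From mathcomp Require Import complex reals.
From mathcomp Require Import mpoly ring zify separable.
From mathcomp Require Import boolp classical_sets functions cardinality topology.

Set Implicit Arguments.
Unset Strict Implicit.
Unset Printing Implicit Defensive.

Import Order.TTheory GRing.Theory Num.Theory.

Local Open Scope classical_set_scope.
Local Open Scope ring_scope.

(** * Forms as functions on K^3 *)

(** No divisors or line bundles are set up. Each point of the curve carries a chosen vector, and a
    section of O(m) near a point is a quotient [psi / phi] of forms whose degrees differ by m. That
    a global section of this kind is the restriction of a form comes from projecting the curve from
    a point off it: over P^1 the push-forward of O(m) is the sum of the O(m - k) for k < n, and
    sections are read off coefficient by coefficient.

    The count of zeros of B: let a line of E carry k of the n - 2 points. The other lines of E need
    at least one point each, so r <= n - 1 - k. B vanishes at the n - k remaining points of the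
    line, because E does and has no pole left to cancel. The centre of the pencil must be among
    them, and it carries a pole too; a second line through it, that is r >= 2, provides the extra
    zero. For n = 3 only one point is left to join, so r = 1 holds for free and says nothing about
    the third point. *)

Section Forms.
Variable K : fieldType.
Local Notation V := 'cV[K]_3.

(** Forms are functions here, so that products, substitutions and identities on the curve become
    computations in K. The zero function is a form of every degree. *)
Definition form (d : nat) (f : V -> K) : Prop :=
  exists2 G : {mpoly K[3]}, G \is d.-homog & f =1 mpeval G.

Lemma form_mpeval d (G : {mpoly K[3]}) : G \is d.-homog -> form d (mpeval G).
Proof. by exists G. Qed.

Lemma form0 d : form d (fun=> 0).
Proof. by exists 0; [exact: dhomog0|move=> v; rewrite /mpeval meval0]. Qed.

Lemma form_cst c : form 0 (fun=> c).
Proof.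
exists c%:MP; last by move=> v; rewrite /mpeval mevalC.
by rewrite -[_%:MP]mulr1 mul_mpolyC rpredZ ?dhomog1.
Qed.

Lemma form_coord i : form 1 (fun v => v i 0).
Proof.
exists 'X_i; last by move=> v; rewrite /mpeval mevalXU.
by rewrite dhomogX /= mdeg1.
Qed.

Lemma formD d f g : form d f -> form d g -> form d (fun v => f v + g v).
Proof.
move=> [G hG fE] [H hH gE]; exists (G + H); first exact: rpredD.
by move=> v; rewrite fE gE /mpeval mevalD.
Qed.

Lemma formM d e f g : form d f -> form e g -> form (d + e) (fun v => f v * g v).
Proof.
move=> [G hG fE] [H hH gE]; exists (G * H); first exact: dhomogM.
by move=> v; rewrite fE gE /mpeval mevalM.
Qed.

Lemma formZ d c f : form d f -> form d (fun v => c * f v).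
Proof. by move=> hf; have := formM (form_cst c) hf. Qed.

Lemma formN d f : form d f -> form d (fun v => - f v).
Proof.
move=> /(formZ (-1)); suff -> : (fun v => -1 * f v) = fun v => - f v by [].
by apply/funext => v; rewrite mulN1r.
Qed.

Lemma formB d f g : form d f -> form d g -> form d (fun v => f v - g v).
Proof. by move=> hf hg; apply/(formD hf)/formN. Qed.

Lemma form_sum (I : Type) (r : seq I) (P : pred I) d (f : I -> V -> K) :
  (forall i, P i -> form d (f i)) -> form d (fun v => \sum_(i <- r | P i) f i v).
Proof.
move=> hf; elim: r => [|i r IH].
  rewrite (_ : (fun v => _) = fun=> 0); first exact: form0.
  by apply/funext => v; rewrite big_nil.
rewrite (_ : (fun v => _) = fun v => if P i then f i v + \sum_(j <- r | P j) f j v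
    else \sum_(j <- r | P j) f j v); last by apply/funext => v; rewrite big_cons.
by case Pi: (P i) => //; apply: formD => //; apply: hf.
Qed.

Lemma formX d k f : form d f -> form (d * k) (fun v => f v ^+ k).
Proof.
move=> hf; elim: k => [|k IH]; first by rewrite muln0; exact: form_cst.
rewrite mulnS (_ : (fun v => _) = fun v => f v * f v ^+ k); first exact: formM.
by apply/funext => v; rewrite exprS.
Qed.

Lemma form_homog d f c v : form d f -> f (c *: v) = c ^+ d * f v.
Proof. by move=> [G hG fE]; rewrite !fE (mpevalZ _ _ hG). Qed.

(** Every monomial of positive degree contains a variable. This yields [form_ind], an induction on
    forms that never mentions monomials. *)
Lemma formSP d f : form d.+1 f ->
  exists2 g : 'I_3 -> V -> K, forall i, form d (g i) &
    forall v, f v = \sum_i v i 0 * g i v.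
Proof.
move=> [G hG fE].
pose T (G : {mpoly K[3]}) := exists2 g : 'I_3 -> V -> K, forall i, form d (g i) &
    forall v, mpeval G v = \sum_i v i 0 * g i v.
suff [g hg gE] : T G by exists g => // v; rewrite fE.
rewrite [G]mpolyE big_seq; apply: (big_ind T).
- exists (fun _ _ => 0) => [i|v]; first exact: form0.
  by rewrite /mpeval meval0 big1 // => i _; rewrite mulr0.
- move=> G1 G2 [g1 h1 E1] [g2 h2 E2]; exists (fun i v => g1 i v + g2 i v).
    by move=> i; apply: formD.
  move=> v; rewrite /mpeval mevalD -!/(mpeval _ _) E1 E2 -big_split /=.
  by apply: eq_bigr => i _; rewrite mulrDr.
move=> m /(dhomog_mf hG) dm; have [i mi] : exists i, (0 < m i)%N.
  apply/existsP; apply: contra_eqT dm => /existsPn m0.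
  by rewrite /= mdegE big1 // => i _; apply/eqP; rewrite -leqn0 leqNgt m0.
have mE : m = (U_(i) + (m - U_(i)))%MM.
  by rewrite addmC submK //; apply/mnm_lepP => j; rewrite mnm1E; case: eqP => [<-|].
exists (fun j v => if j == i then G@_m * mpeval 'X_[m - U_(i)] v else 0).
  move=> j; case: (j == i); last exact: form0.
  apply/formZ/form_mpeval; rewrite dhomogX /=; apply/eqP/succn_inj.
  by move: dm => /= <-; rewrite {2}mE mdegD mdeg1 add1n.
move=> v; rewrite (bigD1 i) //= eqxx big1 ?addr0.
  by rewrite {1}/mpeval mevalZ {2}mE mpolyXD mevalM mevalXU mulrCA.
by move=> j /negPf->; rewrite mulr0.
Qed.

Lemma form_ind (P : nat -> (V -> K) -> Prop) :
  (forall c, P 0%N (fun=> c)) ->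
  (forall d (g : 'I_3 -> V -> K), (forall i, form d (g i)) ->
     (forall i, P d (g i)) -> P d.+1 (fun v => \sum_i v i 0 * g i v)) ->
  forall d f, form d f -> P d f.
Proof.
move=> P0 PS; elim=> [|d IH] f hf.
  suff -> : f = fun=> f 0 by exact: P0.
  apply/funext => v; case: hf => G hG fE; rewrite !fE -(scale0r v).
  by rewrite (mpevalZ _ _ hG) expr0 mul1r.
have [g hg gE] := formSP hf; have -> : f = fun v => \sum_i v i 0 * g i v.
  exact/funext.
by apply: PS => // i; apply: IH.
Qed.

Definition lin (r : 'rV[K]_3) (v : V) : K := (r *m v) 0 0.

Lemma linE r v : lin r v = \sum_i r 0 i * v i 0.
Proof. by rewrite /lin mxE. Qed.
Lemma linD r v w : lin r (v + w) = lin r v + lin r w.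
Proof. by rewrite /lin mulmxDr mxE. Qed.
Lemma linZ r c v : lin r (c *: v) = c * lin r v.
Proof. by rewrite /lin -scalemxAr mxE. Qed.
Lemma linDl r s v : lin (r + s) v = lin r v + lin s v.
Proof. by rewrite /lin mulmxDl mxE. Qed.
Lemma linZl c r v : lin (c *: r) v = c * lin r v.
Proof. by rewrite /lin -scalemxAl mxE. Qed.
Lemma lin0 r : lin r 0 = 0.
Proof. by rewrite /lin mulmx0 mxE. Qed.

Lemma lin_row (A : 'M[K]_3) i v : lin (row i A) v = (A *m v) i 0.
Proof. by rewrite /lin -row_mul [LHS]mxE. Qed.
Lemma lin_delta j v : lin (delta_mx 0 j) v = v j 0.
Proof. by rewrite /lin -rowE mxE. Qed.

Lemma form_lin r : form 1 (lin r).
Proof.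
have -> : lin r = fun v => \sum_i r 0 i * v i 0 by apply/funext => v; rewrite linE.
by apply: form_sum => i _; apply/formZ/form_coord.
Qed.

Lemma lin_form f : form 1 f -> exists r, f =1 lin r.
Proof.
move=> /formSP[g hg gE]; exists (\row_i g i 0) => v.
rewrite gE linE; apply: eq_bigr => i _; rewrite mxE mulrC; congr (_ * _).
by rewrite -[0 in RHS](scale0r v) (form_homog _ _ (hg i)) expr0 mul1r.
Qed.

Lemma form_comp d f (g : 'M[K]_3) : form d f -> form d (fun v => f (g *m v)).
Proof.
elim/form_ind => {d f} [c|d h hh IH]; first exact: form_cst.
apply: form_sum => i _; rewrite -add1n; apply: formM (IH i).
have -> : (fun v : V => (g *m v) i 0) = lin (row i g).
  by apply/funext => v; rewrite lin_row.
exact: form_lin.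
Qed.

(** The coefficient of [t ^ d] is the value at [a], the point at infinity of the line for the
    parameter [t]; if it is nonzero, no zero is lost there. *)
Lemma form_line d f w a : form d f ->
  exists p : {poly K}, [/\ (size p <= d.+1)%N, p`_d = f a &
    forall t, p.[t] = f (w + t *: a)].
Proof.
elim/form_ind => {d f} [c|d g _ IH].
  by exists c%:P; rewrite size_polyC leq_b1 coefC; split=> // t; rewrite hornerC.
have /boolp.choice[p hp] := IH.
exists (\sum_i ((w i 0)%:P + (a i 0)%:P * 'X) * p i); split.
- apply: (leq_trans (size_sum _ _ _)); apply/bigmax_leqP => i _.
  have [sp _ _] := hp i; rewrite mulrDl mul_polyC -mulrA mul_polyC.
  apply: (leq_trans (size_polyD _ _)); rewrite geq_max; apply/andP; split.
    by apply: (leq_trans (size_scale_leq _ _)); apply: leqW.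
  apply: (leq_trans (size_scale_leq _ _)); rewrite mulrC.
  by apply: (leq_trans (size_polyMleq _ _)); rewrite size_polyX addn2.
- rewrite coef_sum; apply: eq_bigr => i _; have [sp <- _] := hp i.
  rewrite mulrDl coefD coefCM nth_default ?mulr0 ?add0r //.
  by rewrite -mulrA coefCM coefXM.
move=> t; rewrite horner_sum; apply: eq_bigr => i _; have [_ _ <-] := hp i.
by rewrite hornerM hornerD hornerM !hornerC hornerX !mxE [t * _]mulrC.
Qed.

Definition dir_deriv (G : {mpoly K[3]}) (v y : V) : K :=
  \sum_j y j 0 * mpeval G^`M(j) v.

Lemma dir_derivD G v y z :
  dir_deriv G v (y + z) = dir_deriv G v y + dir_deriv G v z.
Proof. by rewrite -big_split; apply: eq_bigr => j _; rewrite mxE mulrDl. Qed.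

Lemma dir_derivZ G v c y : dir_deriv G v (c *: y) = c * dir_deriv G v y.
Proof. by rewrite mulr_sumr; apply: eq_bigr => j _; rewrite mxE mulrA. Qed.

(** The expansion holds for constants and variables and is stable under sums and products. [Q]
    depends on [v] and [y]. *)
Lemma taylor G (v y : V) : exists Q : {poly K}, forall t,
  mpeval G (v + t *: y) = mpeval G v + t * dir_deriv G v y + t ^+ 2 * Q.[t].
Proof.
pose T (G : {mpoly K[3]}) := exists Q : {poly K}, forall t,
  mpeval G (v + t *: y) = mpeval G v + t * dir_deriv G v y + t ^+ 2 * Q.[t].
have TC c : T c%:MP.
  exists 0 => t; rewrite /mpeval !mevalC hornerC mulr0 addr0 /dir_deriv big1.
    by rewrite mulr0 addr0.
  by move=> j _; rewrite mderivC /mpeval meval0 mulr0.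
have TX i : T 'X_i.
  exists 0 => t; rewrite /mpeval !mevalXU hornerC mulr0 addr0 !mxE.
  rewrite /dir_deriv (bigD1 i) //= big1 ?addr0.
    by rewrite mderivX mnm1E eqxx scale1r -{1}[U_(i)%MM]add0m addmK mpolyX0 /mpeval meval1 mulr1.
  by move=> j /negPf ji; rewrite mderivX mnm1E eq_sym ji scale0r /mpeval meval0 mulr0.
have TD G1 G2 : T G1 -> T G2 -> T (G1 + G2).
  move=> [Q1 E1] [Q2 E2]; exists (Q1 + Q2) => t.
  have -> : dir_deriv (G1 + G2) v y = dir_deriv G1 v y + dir_deriv G2 v y.
    by rewrite -big_split; apply: eq_bigr => j _; rewrite /mpeval mderivD mevalD mulrDr.
  rewrite /mpeval !mevalD -!/(mpeval _ _) E1 E2 hornerD; ring.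
have TM G1 G2 : T G1 -> T G2 -> T (G1 * G2).
  move=> [Q1 E1] [Q2 E2].
  exists ((mpeval G1 v)%:P * Q2 + (mpeval G2 v)%:P * Q1
    + (dir_deriv G1 v y * dir_deriv G2 v y)%:P
    + 'X * ((dir_deriv G1 v y)%:P * Q2 + (dir_deriv G2 v y)%:P * Q1)
    + 'X^2 * (Q1 * Q2)) => t.
  have -> : dir_deriv (G1 * G2) v y =
      dir_deriv G1 v y * mpeval G2 v + mpeval G1 v * dir_deriv G2 v y.
    rewrite mulr_suml mulr_sumr -big_split; apply: eq_bigr => j _.
    by rewrite /mpeval mderivM mevalD !mevalM /=; ring.
  rewrite /mpeval !mevalM -!/(mpeval _ _) E1 E2 !hornerE /=; ring.
have T1 : T 1 by exact: (TC 1).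
rewrite -/(T G) [G]mpolyE; apply: (big_ind T) => // [|m _]; first exact: (TC 0).
rewrite -mul_mpolyC; apply: (TM) => //; rewrite mpolyXE_id; apply: (big_ind T T1 TM) => i _.
by elim: (m i) => [|k IH]; rewrite ?expr0 // exprS; apply: (TM).
Qed.

End Forms.

(** * Frames and division of forms *)

Section Frames.
Variable K : fieldType.
Local Notation V := 'cV[K]_3.

Definition indep (v w : V) := forall s t, s *: v + t *: w = 0 -> s = 0 /\ t = 0.

Lemma indepP (v w : V) : w != 0 -> (forall c, v <> c *: w) -> indep v w.
Proof.
move=> w0 vw s t /eqP; rewrite addr_eq0 => /eqP E.
have s0 : s = 0.
  apply/eqP/negPn/negP => s0; apply: (vw (- (s^-1 * t))).
  by rewrite scaleNr -scalerA -scalerN -E scalerA mulVf ?scale1r.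
move: E; rewrite s0 scale0r => /esym/eqP; rewrite oppr_eq0 scaler_eq0 (negPf w0) orbF.
by move=> /eqP.
Qed.

(** A basis with its dual basis: coordinates adapted to given points and lines. The line [a = 0] is
    spanned by [v] and [w]. *)
Definition frame (u v w : V) (a b c : 'rV[K]_3) : Prop :=
  (forall y, y = lin a y *: u + lin b y *: v + lin c y *: w) /\
  (forall x y z, [/\ lin a (x *: u + y *: v + z *: w) = x,
     lin b (x *: u + y *: v + z *: w) = y & lin c (x *: u + y *: v + z *: w) = z]).

Lemma frame_swap u v w a b c : frame u v w a b c -> frame v u w b a c.
Proof.
move=> [E U]; split=> [y|x y z]; first by rewrite [_ *: v + _]addrC -E.
by rewrite [x *: v + _]addrC; have [-> -> ->] := U y x z.
Qed.

Lemma frame_rot u v w a b c : frame u v w a b c -> frame v w u b c a.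
Proof.
move=> [E U]; split=> [y|x y z]; first by rewrite addrC addrA -E.
by rewrite addrC addrA; have [-> -> ->] := U z x y.
Qed.

Lemma frame_unit (g : 'M[K]_3) (h := invmx g) : g \in unitmx ->
  frame (col 0 g) (col 1 g) (col 2 g) (row 0 h) (row 1 h) (row 2 h).
Proof.
move=> gU.
have colE (x : V) : g *m x = x 0 0 *: col 0 g + x 1 0 *: col 1 g + x 2 0 *: col 2 g.
  apply/colP => i; rewrite !mxE !big_ord_recl big_ord0 addr0 addrA.
  by congr (_ + _ + _); rewrite mulrC; congr (x _ _ * g _ _); apply/val_inj.
split=> [y|x y z]; first by rewrite !lin_row -colE mulmxA mulmxV ?mul1mx.
pose t : V := \col_i nth 0 [:: x; y; z] i.
have -> : x *: col 0 g + y *: col 1 g + z *: col 2 g = g *m t by rewrite colE !mxE.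
by rewrite !lin_row mulmxA mulVmx // mul1mx !mxE.
Qed.

Lemma frame_ex2 (v w : V) : indep v w -> exists u a b c, frame u v w a b c.
Proof.
move=> ivw.
pose A : 'M[K]_(1 + 1, 3) := col_mx v^T w^T.
have rA : \rank A = 2%N.
  apply/eqP; rewrite -/(row_free A) -kermx_eq0 -submx0; apply/rV_subP.
  move=> x; change 'rV[K]_(1 + 1) in x.
  rewrite sub_kermx /A -(hsubmxK x) mul_row_col => /eqP E.
  have [] := ivw (lsubmx x 0 0) (rsubmx x 0 0).
    apply/trmx_inj; rewrite linearD !linearZ trmx0 -E.
    by rewrite [in RHS](mx11_scalar (lsubmx x)) [in RHS](mx11_scalar (rsubmx x)) !mul_scalar_mx.
  move=> l0 r0; rewrite (mx11_scalar (lsubmx x)) (mx11_scalar (rsubmx x)) l0 r0.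
  by rewrite !raddf0 row_mx0 sub0mx.
pose U : 'M[K]_(1 + 1, 3) := pid_mx 2; pose f := (pid_mx 2 : 'M[K]_(3, 1 + 1)) *m A.
have Uf : U *m f = A by rewrite mulmxA pid_mx_id // pid_mx_1 mul1mx.
(* An invertible [g] whose first two rows are [v] and [w]; its transpose gives the frame. *)
have [|g gU] := @complete_unitmx _ _ _ U f; first by rewrite Uf rA rank_pid_mx.
rewrite Uf => gE.
have gT : g^T \in unitmx by rewrite unitmx_tr.
have rowg (i : 'I_(1 + 1)) (k : 'I_3) : i = k :> nat -> row k g = row i A.
  move=> ik; rewrite gE; apply/rowP => j; rewrite !mxE (bigD1 k) //= big1 ?addr0.
    by rewrite mxE ik eqxx -ik ltn_ord mul1r.
  by move=> l lk; rewrite mxE ik eq_sym (negPf lk : (l == k :> nat) = false) mul0r.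
have := frame_unit gT; have -> : col 0 g^T = v.
  rewrite -tr_row; apply/trmx_inj; rewrite trmxK (rowg (lshift 1 0)) //.
  by apply/rowP => j; rewrite rowKu row_id.
have -> : col 1 g^T = w.
  rewrite -tr_row; apply/trmx_inj; rewrite trmxK (rowg (rshift 1 0)) //.
  by apply/rowP => j; rewrite rowKd row_id.
by move=> /frame_rot/frame_rot fr; do 4! eexists; exact: fr.
Qed.

Lemma frame_ex1 (w : V) : w != 0 -> exists u v a b c, frame u v w a b c.
Proof.
move=> /cV0Pn[i wi].
have [j ij] : exists j : 'I_3, i != j.
  by exists (if i == 0 then 1 else 0); case: ifP => [/eqP ->|->].
have [|u [a [b [c fr]]]] := @frame_ex2 (delta_mx j 0) w.
  move=> s t E; have t0 : t = 0.
    move: E => /colP/(_ i); rewrite !mxE (negPf ij) mulr0 add0r => /eqP.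
    by rewrite mulf_eq0 (negPf wi) orbF => /eqP.
  split=> //; move: E => /colP/(_ j); rewrite t0 scale0r addr0 !mxE !eqxx.
  by rewrite mulr1.
by exists u, (delta_mx j 0), a, b, c.
Qed.

Section InFrame.
Variables (u v w : V) (a b c : 'rV[K]_3).
Hypothesis fr : frame u v w a b c.

Lemma frameE y : y = lin a y *: u + lin b y *: v + lin c y *: w.
Proof. exact: fr.1. Qed.

Lemma frame_coord x y z : [/\ lin a (x *: u + y *: v + z *: w) = x,
  lin b (x *: u + y *: v + z *: w) = y & lin c (x *: u + y *: v + z *: w) = z].
Proof. exact: fr.2. Qed.

Lemma frame_u : [/\ lin a u = 1, lin b u = 0 & lin c u = 0].
Proof. by have := frame_coord 1 0 0; rewrite !scale0r scale1r !addr0. Qed.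

Lemma frame_v : [/\ lin a v = 0, lin b v = 1 & lin c v = 0].
Proof. by have := frame_coord 0 1 0; rewrite !scale0r scale1r addr0 add0r. Qed.

Lemma frame_w : [/\ lin a w = 0, lin b w = 0 & lin c w = 1].
Proof. by have := frame_coord 0 0 1; rewrite !scale0r scale1r !add0r. Qed.

Let p y := lin b y *: v + lin c y *: w.

(** Division by the linear form [a]: the remainder is the restriction to [a = 0], pulled back by the
    projection from [u]. *)
Lemma form_divl d f : form d.+1 f -> exists2 g, form d g &
  forall y, f y = lin a y * g y + f (lin b y *: v + lin c y *: w).
Proof.
have hp i : form 1 (fun y => p y i 0).
  rewrite (_ : (fun y => _) = fun y => v i 0 * lin b y + w i 0 * lin c y).
    by apply: formD; apply/formZ/form_lin.
  by apply/funext => y; rewrite !mxE mulrC [_ * w i 0]mulrC.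
elim: d f => [|d IH] f /formSP[g hg gE].
  exists (fun y => \sum_i u i 0 * g i y).
    by apply: form_sum => i _; apply: formZ.
  move=> y; rewrite !gE mulr_sumr -big_split; apply: eq_bigr => i _ /=.
  rewrite {1}(frameE y) !mxE.
  have gc z : g i z = g i 0.
    by rewrite -[0](scale0r z) (form_homog _ _ (hg i)) expr0 mul1r.
  by rewrite (gc (_ + _)) (gc y); ring.
have /boolp.choice[h hE] : forall i, exists h, form d h /\
    forall y, g i y = lin a y * h y + g i (p y).
  by move=> i; have [h h1 h2] := IH _ (hg i); exists h.
exists (fun y => \sum_i u i 0 * g i y + \sum_i p y i 0 * h i y).
  apply: formD; apply: form_sum => i _; first exact: formZ.
  by rewrite -add1n; apply: formM => //; have [] := hE i.
move=> y; rewrite !gE mulrDr !mulr_sumr -!big_split; apply: eq_bigr => i _ /=.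
have [_ /(_ y) E] := hE i.
by rewrite {1}(frameE y) E !mxE /p; ring.
Qed.

Lemma form_div_vanish d f : form d.+1 f ->
  (forall s t, f (s *: v + t *: w) = 0) ->
  exists2 g, form d g & forall y, f y = lin a y * g y.
Proof.
move=> /form_divl[g hg gE] f0; exists g => // y; by rewrite gE f0 addr0.
Qed.

End InFrame.

(** Divide by [a], then divide the restriction to [a = 0] by [b]; what remains is [f w] times a
    power of [c]. *)
Lemma form_div_point u v w a b c d f : frame u v w a b c -> form d.+1 f ->
  f w = 0 -> exists g1 g2, [/\ form d g1, form d g2 &
    forall y, f y = lin a y * g1 y + lin b y * g2 y].
Proof.
move=> fr hf fw.
have [g1 h1 E1] := form_divl fr hf.
have [g2 h2 E2] := form_divl (frame_rot fr) hf.
exists g1, (fun y => g2 ((v *m b + w *m c) *m y)); split=> // [|y].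
  exact: form_comp.
have -> : (v *m b + w *m c) *m y = lin b y *: v + lin c y *: w.
  rewrite mulmxDl -!mulmxA [b *m y]mx11_scalar [c *m y]mx11_scalar.
  by rewrite !mul_mx_scalar.
rewrite {1}E1 E2; have := frame_coord fr 0 (lin b y) (lin c y).
rewrite scale0r add0r => -[-> -> ->].
by rewrite scale0r addr0 (form_homog _ _ hf) fw mulr0 addr0.
Qed.

End Frames.

(** * General position over an algebraically closed field *)

Section Closed.
Variable K : numClosedFieldType.
Local Notation V := 'cV[K]_3.

Lemma finite_roots (p : {poly K}) : p != 0 -> finite_set [set t | p.[t] = 0].
Proof.
move=> p0; have [rs rsE] := closed_field_poly_normal p.
apply: (sub_finite_set _ (finite_seq rs)) => t /= pt.
have : root p t by apply/eqP.
by rewrite rsE rootZ ?lead_coef_eq0 // root_prod_XsubC.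
Qed.

Lemma infinite_field : infinite_set [set: K].
Proof.
move=> fK; apply: infinite_nat.
have /= := @finite_image _ _ _ (fun x : K => xget 0%N [set k | x = k%:R]) fK.
apply: sub_finite_set => k _ /=; exists k%:R => //.
by case: xgetP => [j _ /eqP|/(_ k)] //=; rewrite eqr_nat => /eqP ->.
Qed.

(** The source of all general choices: each bad condition on a parameter is shown to be finite. *)
Lemma cofinite_ex (A : set K) : finite_set A -> exists t, ~ A t.
Proof.
move=> fA; apply/existsNP => AT; apply: infinite_field.
by apply: (sub_finite_set _ fA) => t _.
Qed.

Lemma cofinite_ex2 (A B : set K) : finite_set A -> finite_set B ->
  exists t, ~ A t /\ ~ B t.
Proof.
move=> fA fB; have [|t /not_orP] := @cofinite_ex (A `|` B); last by exists t.
by rewrite finite_setU.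
Qed.

Lemma poly_cofinite_eq0 (A : set K) (p : {poly K}) : finite_set A ->
  (forall t, ~ A t -> p.[t] = 0) -> p = 0.
Proof.
move=> fA p0; apply/eqP/negPn/negP => /finite_roots fp.
have [|t] := @cofinite_ex (A `|` [set t | p.[t] = 0]); first by rewrite finite_setU.
by apply; have [|/p0] := EM (A t); [left|right].
Qed.

Lemma poly_eq0 (p : {poly K}) : (forall t, p.[t] = 0) -> p = 0.
Proof. by move=> p0; apply: (poly_cofinite_eq0 (finite_set0 K)). Qed.

Lemma form_line_zero d f (v w : V) : form d.+1 f ->
  exists s t, (s, t) != (0, 0) /\ f (s *: v + t *: w) = 0.
Proof.
move=> /(form_line v w)[p [sp pd pE]].
have [fw|fw] := eqVneq (f w) 0.
  by exists 0, 1; rewrite scale0r add0r scale1r xpair_eqE oner_eq0 andbF.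
have : size p != 1%N.
  by apply: contraNneq fw => s1; rewrite -pd nth_default ?s1.
move=> /closed_rootP[t /eqP pt]; exists 1, t.
by rewrite scale1r -pE xpair_eqE oner_eq0.
Qed.

End Closed.

(** * Transversal lines of a pencil *)

Section Specialization.
Variable K : numClosedFieldType.
Local Notation V := 'cV[K]_3.

(** The inner variable x, which parametrizes a pencil of lines or the base of a projection, is
    specialized; the outer one runs along a line. *)
Definition spec (x : K) (P : {poly {poly K}}) : {poly K} :=
  map_poly (horner_eval x) P.

Lemma specE x P t : (spec x P).[t] = P.[t%:P].[x].
Proof.
have -> : t = horner_eval x t%:P by rewrite /horner_eval hornerC.
by rewrite horner_map /horner_eval !hornerC.
Qed.

Lemma spec_neq0 (P : {poly {poly K}}) : P != 0 -> finite_set [set x | (lead_coef P).[x] = 0].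
Proof. by move=> P0; apply: finite_roots; rewrite lead_coef_eq0. Qed.

Lemma deriv_poly2_neq0 (d : {poly {poly K}}) : (1 < size d)%N -> d^`() != 0.
Proof.
move=> d1; apply/negP => /eqP/polyP/(_ (size d).-2); rewrite coef_deriv coef0.
have -> : ((size d).-2.+1 = (size d).-1)%N by case: (size d) d1 => [|[|]].
rewrite -lead_coefE -mulr_natl -polyC_natr => /eqP.
rewrite mulf_eq0 polyC_eq0 pnatr_eq0 lead_coef_eq0 -size_poly_eq0.
by case: (size d) d1 => [|[|]].
Qed.

Definition poly2 (g : K -> K -> K) :=
  exists P : {poly {poly K}}, forall x t, P.[t%:P].[x] = g x t.

Lemma poly2_cst c : poly2 (fun _ _ => c).
Proof. by exists c%:P%:P => x t; rewrite !hornerC. Qed.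
Lemma poly2_fst : poly2 (fun x _ : K => x).
Proof. by exists ('X)%:P => x t; rewrite hornerC hornerX. Qed.
Lemma poly2_snd : poly2 (fun _ t : K => t).
Proof. by exists 'X => x t; rewrite hornerX hornerC. Qed.
Lemma poly2D g h : poly2 g -> poly2 h -> poly2 (fun x t => g x t + h x t).
Proof. by move=> [P PE] [Q QE]; exists (P + Q) => x t; rewrite !hornerD PE QE. Qed.
Lemma poly2M g h : poly2 g -> poly2 h -> poly2 (fun x t => g x t * h x t).
Proof. by move=> [P PE] [Q QE]; exists (P * Q) => x t; rewrite !hornerM PE QE. Qed.

Lemma poly2_form d f (A : K -> K -> V) : form d f ->
  (forall i, poly2 (fun x t => A x t i 0)) -> poly2 (fun x t => f (A x t)).
Proof.
move=> hf hA; elim/form_ind: d f / hf => [c|d g _ IH]; first exact: poly2_cst.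
have sumP (s : seq 'I_3) :
    poly2 (fun x t => \sum_(i <- s) A x t i 0 * g i (A x t)).
  elim: s => [|i s IHs].
    by have [P PE] := poly2_cst 0; exists P => x t; rewrite big_nil PE.
  have [P PE] := poly2D (poly2M (hA i) (IH i)) IHs.
  by exists P => x t; rewrite big_cons PE.
exact: sumP.
Qed.

Lemma poly2_ext g h : (forall x t, g x t = h x t) -> poly2 g -> poly2 h.
Proof. by move=> gh [P PE]; exists P => x t; rewrite PE. Qed.

End Specialization.

Section SmoothForms.
Variables (K : numClosedFieldType) (n : nat) (F : {mpoly K[3]}).
Local Notation V := 'cV[K]_3.
Local Notation f := (mpeval F).
Local Notation D := (dir_deriv F).
Hypothesis hF : F \is n.-homog.
Hypothesis F_smooth : forall v, v != 0 -> f v = 0 -> exists y, D v y != 0.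
Hypothesis n_gt1 : (1 < n)%N.

Let fF : form n f := form_mpeval hF.

(** The factor [C] absorbs what pseudo-division leaves in front of [f]; being nonzero at 0, it does
    not affect the order of vanishing. *)
Lemma double_root_deriv (C R : {poly K}) p y : C.[0] != 0 ->
  (forall t, C.[t] * f (p + t *: y) = t ^+ 2 * R.[t]) -> f p = 0 /\ D p y = 0.
Proof.
move=> C0 E; have [Q QE] := taylor F p y.
have : C * ((f p)%:P + 'X * (D p y)%:P + 'X^2 * Q) - 'X^2 * R = 0.
  by apply: poly_eq0 => t; rewrite !hornerE /= -E QE subrr.
move=> /eqP; rewrite subr_eq0 => /eqP EQ.
have fp : f p = 0.
  have /(congr1 (fun q : {poly K} => q.[0])) := EQ.
  rewrite !hornerE /= ?(mul0r, addr0, expr0n) /= => /eqP.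
  by rewrite mulf_eq0 (negPf C0) /= => /eqP.
split=> //; have : C * ((D p y)%:P + 'X * Q) - 'X * R = 0.
  have X0 : 'X != 0 :> {poly K} by rewrite polyX_eq0.
  apply: (mulfI X0); rewrite mulr0 mulrBr; apply/eqP; rewrite subr_eq0.
  by apply/eqP; rewrite [RHS]mulrA -expr2 -EQ fp; ring.
move=> /eqP; rewrite subr_eq0 => /eqP /(congr1 (fun q : {poly K} => q.[0])).
rewrite !hornerE /= ?(mul0r, addr0, expr0n) /= => /eqP.
by rewrite mulf_eq0 (negPf C0) /= => /eqP.
Qed.

Lemma deriv_along_zero p y : (forall t, f (p + t *: y) = 0) -> D p y = 0.
Proof.
move=> E; have [||//] := @double_root_deriv 1 0 p y; first by rewrite hornerC oner_neq0.
by move=> t; rewrite E horner0 !mulr0.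
Qed.

Lemma euler p : f p = 0 -> D p p = 0.
Proof.
move=> fp; apply: deriv_along_zero => t.
by rewrite -{1}[p]scale1r -scalerDl (form_homog _ _ fF) fp mulr0.
Qed.

Lemma dir_deriv_frame u v w a b c p : frame u v w a b c ->
  D p u = 0 -> D p v = 0 -> D p w = 0 -> forall y, D p y = 0.
Proof.
move=> fr Du Dv Dw y; rewrite (frameE fr y) !dir_derivD !dir_derivZ.
by rewrite Du Dv Dw !mulr0 !addr0.
Qed.

Lemma form_dir_deriv y : form n.-1 (fun p => D p y).
Proof.
apply: form_sum => j _; apply/formZ/form_mpeval.
rewrite (mpolyE F) raddf_sum /= big_seq; apply: rpred_sum => m /(dhomog_mf hF) /= dm.
rewrite mderivZ mderivX; apply: rpredZ; have [->|mj] := eqVneq (m j) 0%N.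
  by rewrite scale0r rpred0.
have Um : (m - U_(j) + U_(j))%MM = m.
  by apply/submK/mnm_lepP => i; rewrite mnm1E; case: eqP => [<-|//]; rewrite lt0n.
by apply: rpredZ; rewrite dhomogX /= -dm -{2}Um mdegD mdeg1 addn1.
Qed.

(** On a line inside the curve the derivatives along the line vanish, and the transverse one is a
    form of degree n - 1 > 0, hence has a zero there: a singular point. *)
Lemma line_not_in_curve u v w a b c : frame u v w a b c ->
  exists s t, f (s *: v + t *: w) != 0.
Proof.
move=> fr; apply/not_existsP => f0.
have {}f0 s t : f (s *: v + t *: w) = 0.
  by apply/eqP/negPn/negP => st; apply: (f0 s); exists t.
have [s [t [st0 Dst]]] : exists s t, (s, t) != (0, 0) /\ D (s *: v + t *: w) u = 0.
  have := form_dir_deriv u; case: n n_gt1 => [|[|m]] // _; exact: form_line_zero.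
have p0 : s *: v + t *: w != 0.
  apply: contraNneq st0 => E; have := frame_coord fr 0 s t.
  by rewrite scale0r add0r E !lin0 => -[_ <- <-].
have [y] := F_smooth p0 (f0 s t); rewrite (dir_deriv_frame fr) ?eqxx //.
  apply: deriv_along_zero => r.
  by rewrite addrAC -scalerDl f0.
by apply: deriv_along_zero => r; rewrite -addrA -scalerDl f0.
Qed.

(** With [f y != 0] the point [y] at infinity is off the curve, so the parameters [ts] account for
    the whole section. The centre [w] may be on the curve, with parameter 0. *)
Definition transversal_section (w y : V) (ts : seq K) : Prop :=
  [/\ f y != 0, uniq ts, size ts = n,
      forall t, (t \in ts) = (f (w + t *: y) == 0) &
      forall t, t \in ts -> D (w + t *: y) y != 0].

Lemma spec_pencil (P : {poly {poly K}}) u v w :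
  (forall x t, P.[t%:P].[x] = f (w + t *: (u + x *: v))) ->
  forall x, (size (spec x P) <= n.+1)%N /\ (spec x P)`_n = f (u + x *: v).
Proof.
move=> PE x; have [p [sp pn pE]] := form_line w (u + x *: v) fF.
suff -> : spec x P = p by [].
by apply/eqP; rewrite -subr_eq0; apply/eqP/poly_eq0 => t; rewrite !hornerE specE PE pE subrr.
Qed.

Lemma pencil_leading_finite u v w a b c : frame u v w a b c ->
  finite_set [set x | f (u + x *: v) = 0].
Proof.
move=> fr; have [p [sp pn pE]] := form_line u v fF.
have p0 : p != 0.
  have [s [t]] := line_not_in_curve (frame_rot (frame_rot fr)).
  apply: contraNneq => p0; have [->|s0] := eqVneq s 0.
    by rewrite scale0r add0r (form_homog _ _ fF) -pn p0 coef0 mulr0.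
  have -> : s *: u + t *: v = s *: (u + (t / s) *: v).
    by rewrite scalerDr scalerA mulrCA divff ?mulr1.
  by rewrite (form_homog _ _ fF) -pE p0 horner0 mulr0.
by apply: (sub_finite_set _ (finite_roots p0)) => x /=; rewrite pE.
Qed.

(* A square factor d^2 of a pencil P of restrictions of F to the lines through w
   would make F singular at a point of [d = 0]: the derivatives along the line,
   along the pencil parameter and along the radius vector all vanish there. *)
Lemma pencil_separable u v w a b c (P : {poly {poly K}}) : frame u v w a b c ->
  (forall x t, P.[t%:P].[x] = f (w + t *: (u + x *: v))) -> separable_poly P.
Proof.
move=> fr PE; have fu := pencil_leading_finite fr.
have P0 : P != 0.
  have [x fx] := cofinite_ex fu; apply/eqP => P0; apply: fx => /=.
  by have [_ <-] := spec_pencil PE x; rewrite /spec P0 raddf0 coef0.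
apply/separable_polyP; split; last by move=> d _; apply: deriv_poly2_neq0.
apply/poly_square_freeP => d d1; apply/negP => /Pdiv.Idomain.dvdpP[[cc q] /= c0 E].
have d0 : d != 0.
  apply: contra_neq P0 => d0; move/eqP: E; rewrite -mul_polyC d0 expr0n /= mulr0.
  by rewrite mulf_eq0 polyC_eq0 (negPf c0) => /eqP.
have {}d1 : (1 < size d)%N.
  by move: d1 d0; rewrite -size_poly_eq0; case: (size d) => [|[|]].
(* For [w] on the curve these are the lines tangent at [w]. They are avoided because at [t = 0] a
   change of [x] does not move the point, so no derivative along the pencil could be extracted. *)
have fin_w : finite_set [set x | f w = 0 /\ D w (u + x *: v) = 0].
  have [fw|fw] := eqVneq (f w) 0; last first.
    by apply: (sub_finite_set _ (finite_set0 K)) => x [/eqP]; rewrite (negPf fw).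
  pose p := (D w u)%:P + (D w v)%:P * 'X.
  have p0 : p != 0.
    apply/eqP => p0; have w0 : w != 0.
      by apply/eqP => w0; have [_ _ /eqP] := frame_w fr; rewrite w0 lin0 eq_sym oner_eq0.
    have [y] := F_smooth w0 fw; rewrite (dir_deriv_frame fr) ?eqxx //.
    - by have := congr1 (fun r : {poly K} => r`_0) p0; rewrite coefD coefCM coefX mulr0 addr0 coefC coef0.
    - by have := congr1 (fun r : {poly K} => r`_1) p0; rewrite coefD coefCM coefX mulr1 coefC add0r coef0.
    - exact: euler.
  apply: (sub_finite_set _ (finite_roots p0)) => x [_ /=].
  by rewrite dir_derivD dir_derivZ /p !hornerE mulrC.
(* At [x0] the factor [cc] can be cancelled and [d] keeps its degree, hence has a root. *)
have [x0 Nx0] : exists x, ~ ([set x | cc.[x] = 0] `|` [set x | (lead_coef d).[x] = 0]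
    `|` [set x | f w = 0 /\ D w (u + x *: v) = 0]) x.
  by apply: cofinite_ex; rewrite !finite_setU; split=> //; split;
    [exact: finite_roots|exact: spec_neq0].
have cx0 : cc.[x0] != 0 by apply/eqP => h; apply: Nx0; left; left.
have dx0 : (lead_coef d).[x0] != 0 by apply/eqP => h; apply: Nx0; left; right.
have wx0 : ~ (f w = 0 /\ D w (u + x0 *: v) = 0) by move=> h; apply: Nx0; right.
have EE x t : cc.[x] * f (w + t *: (u + x *: v)) = (q.[t%:P] * d.[t%:P] ^+ 2).[x].
  by rewrite -PE -horner_exp -!hornerM -E -mul_polyC hornerCM.
have [t0 /eqP dt0] : exists t, root (spec x0 d) t.
  by apply/closed_rootP; rewrite size_map_poly_id0 // neq_ltn d1 orbT.
have [d' dE] : exists d', spec x0 d = d' * ('X - t0%:P) by apply/factor_theorem/eqP.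
set y := u + x0 *: v; set p := w + t0 *: y.
have [fp Dpy] : f p = 0 /\ D p y = 0.
  apply: (@double_root_deriv (cc.[x0])%:P
    ((spec x0 q \Po ('X + t0%:P)) * (d' \Po ('X + t0%:P)) ^+ 2)).
    by rewrite hornerC.
  move=> t; rewrite hornerC -addrA -scalerDl EE hornerM horner_exp -!specE dE.
  rewrite !hornerE !horner_comp !hornerE /= [t + t0]addrC; ring.
have t00 : t0 != 0.
  by apply/eqP => t00; apply: wx0; move: fp Dpy; rewrite /p t00 scale0r addr0.
(* Varying [x] with [t0] fixed moves the point along [t0 *: v], and [d] vanishes at [x0] in that
   variable as well. *)
have Dpv : D p v = 0.
  have [e eE] : exists e, d.[t0%:P] = e * ('X - x0%:P).
    by apply/factor_theorem/eqP; rewrite -specE.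
  have [] := @double_root_deriv (cc \Po ('X + x0%:P))
    ((q.[t0%:P] * e ^+ 2) \Po ('X + x0%:P)) p (t0 *: v).
  - by rewrite horner_comp !hornerE.
  - move=> t; rewrite horner_comp !hornerE /=.
    have -> : p + t *: (t0 *: v) = w + t0 *: (u + (t + x0) *: v).
      by apply/colP => i; rewrite /p /y !mxE; ring.
    rewrite EE eE !hornerE /= ?horner_exp ?hornerE /=.
    by rewrite horner_comp !hornerE /=; ring.
  by move=> _ /eqP; rewrite dir_derivZ mulf_eq0 (negPf t00) => /eqP.
have Dpu : D p u = 0.
  have -> : u = y + (- x0) *: v by rewrite /y -addrA -scalerDl subrr scale0r addr0.
  by rewrite dir_derivD dir_derivZ Dpy Dpv mulr0 addr0.
have Dpw : D p w = 0.
  have -> : w = p + (- t0) *: y by rewrite /p -addrA -scalerDl subrr scale0r addr0.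
  by rewrite dir_derivD dir_derivZ Dpy mulr0 addr0 euler.
have p0 : p != 0.
  apply/eqP => p0; have [_ _] := frame_coord fr t0 (t0 * x0) 1.
  rewrite scale1r -scalerA -scalerDr addrC -/y -/p p0 lin0 => /eqP.
  by rewrite eq_sym oner_eq0.
by have [z] := F_smooth p0 fp; rewrite (dir_deriv_frame fr) ?eqxx.
Qed.

(** Separability gives a Bezout relation between [P] and its derivative with right-hand side a
    nonzero [e] in K[x]; it specializes to every [x] with [e.[x] != 0]. *)
Lemma transversal_cofinite u v w a b c : frame u v w a b c ->
  finite_set [set x | ~ exists ts, transversal_section w (u + x *: v) ts].
Proof.
move=> fr; have fu := pencil_leading_finite fr.
have [P PE] : poly2 (fun x t => f (w + t *: (u + x *: v))).
  apply: (poly2_form fF) => i.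
  apply: (@poly2_ext _ (fun x t => w i 0 + t * (u i 0 + x * v i 0))).
    by move=> x t; rewrite !mxE.
  apply: poly2D; first exact: poly2_cst.
  apply: poly2M; first exact: poly2_snd.
  apply: poly2D; first exact: poly2_cst.
  by apply: poly2M; [exact: poly2_fst|exact: poly2_cst].
have := pencil_separable fr PE; rewrite unlock => /Pdiv.Idomain.Bezout_coprimepP[[q1 q2] /=].
rewrite -size_poly_eq1 => /size_poly1P[e e0 E].
apply: (sub_finite_set (B := [set x | f (u + x *: v) = 0] `|` [set x | e.[x] = 0])).
  2: by rewrite finite_setU; split=> //; exact: finite_roots.
move=> x /= Nx; have [fx|fx] := eqVneq (f (u + x *: v)) 0; first by left.
have [ex|ex] := eqVneq e.[x] 0; [by right|exfalso; apply: Nx].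
have [sp pn] := spec_pencil PE x.
have {}sp : size (spec x P) = n.+1.
  apply/eqP; rewrite eqn_leq sp ltnNge; apply/negP => /leq_sizeP/(_ n (leqnn n)).
  by rewrite pn => /eqP; rewrite (negPf fx).
have Ex : spec x q1 * spec x P + spec x q2 * (spec x P)^`() = (e.[x])%:P.
  by rewrite /spec deriv_map -!rmorphM -rmorphD E /= map_polyC.
have sepx : coprimep (spec x P) (spec x P)^`().
  by apply/Pdiv.Idomain.Bezout_coprimepP; exists (spec x q1, spec x q2); rewrite Ex polyC_eqp1.
have [ts tsE] := closed_field_poly_normal (spec x P).
have lc0 : lead_coef (spec x P) != 0.
  by rewrite lead_coef_eq0 -size_poly_eq0 sp.
have rootE t : (t \in ts) = (f (w + t *: (u + x *: v)) == 0).
  rewrite -PE -specE -[RHS]/(root (spec x P) t) tsE rootZ //.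
  by rewrite root_prod_XsubC.
exists ts; split=> //.
- have : separable_poly (spec x P) by rewrite unlock.
  by rewrite tsE -mul_polyC separable_mul separable_prod_XsubC => /and3P[].
- by apply/succn_inj; rewrite -sp tsE size_scale // size_prod_XsubC.
(* A zero derivative means a double root, where the left-hand side of the Bezout relation
   vanishes. *)
move=> t; rewrite rootE => /eqP ft; apply/eqP => Dt.
have [Q QE] := taylor F (w + t *: (u + x *: v)) (u + x *: v).
have PQ : spec x P = ('X - t%:P) ^+ 2 * (Q \Po ('X - t%:P)).
  apply/eqP; rewrite -subr_eq0; apply/eqP/poly_eq0 => s.
  rewrite !hornerE /= horner_comp !hornerE specE PE.
  have -> : w + s *: (u + x *: v) = w + t *: (u + x *: v) + (s - t) *: (u + x *: v).
    by apply/colP => i; rewrite !mxE; ring.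
  by rewrite QE ft Dt mulr0 !add0r expr2 subrr.
have := congr1 (fun r : {poly K} => r.[t]) Ex.
rewrite PQ derivM expr2 derivM !derivB !derivX !derivC !hornerE /= => /eqP.
by rewrite !(subrr, mulr0, mul0r, addr0) eq_sym (negPf ex).
Qed.

End SmoothForms.

Section LocalEquation.
Variables (K : numClosedFieldType) (n : nat) (F : {mpoly K[3]}).
Local Notation V := 'cV[K]_3.
Local Notation f := (mpeval F).
Local Notation D := (dir_deriv F).
Hypothesis hF : F \is n.-homog.
Hypothesis n_gt0 : (0 < n)%N.

(* In coordinates (a, b, c) with q = (0 : 0 : 1) and L proportional to a, write
   F = a g1 + b g2 and G = a h1 + b h2; transversality says g2 q != 0, and
   g2 G = a (g2 h1 - g1 h2) modulo F. *)
Lemma transversal_uniformizer L k q y d G : q != 0 -> lin L q = 0 ->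
  lin L y = 0 -> lin L k != 0 -> f q = 0 -> D q y != 0 -> form d.+1 G -> G q = 0 ->
  exists b c, [/\ form n.-1 b, form (n.-1 + d) c, b q != 0 &
    forall v, f v = 0 -> b v * G v = lin L v * c v].
Proof.
move=> q0 Lq Ly Lk fq Dy hG Gq.
have hF' : form n.-1.+1 f by rewrite prednK //; exact: form_mpeval.
have [|k' [a [b [c fr]]]] := @frame_ex2 _ y q.
  apply: indepP => // r yE; move/eqP: Dy; apply.
  by rewrite yE dir_derivZ (euler hF fq) mulr0.
have LE v : lin L v = lin L k' * lin a v.
  by rewrite {1}(frameE fr v) !linD !linZ Lq Ly !mulr0 !addr0 mulrC.
have Lk' : lin L k' != 0 by apply: contraNneq Lk => Lk'; rewrite LE Lk' mul0r.
have [g1 [g2 [hg1 hg2 FE]]] := form_div_point fr hF' fq.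
have [h1 [h2 [hh1 hh2 GE]]] := form_div_point fr hG Gq.
exists g2, (fun v => (lin L k')^-1 * (g2 v * h1 v - g1 v * h2 v)); split=> //.
- by apply/formZ/formB; apply: formM.
(* On the line [a = 0] one has [f (q + t *: y) = t * g2 (q + t *: y)], so a zero of [g2] at [q]
   would be a double zero of [f]. *)
- apply: contraNneq Dy => g2q.
  have [p [_ _ pE]] := form_line q y hg2.
  have [r rE] : exists r, p = r * ('X - 0%:P).
    by apply/factor_theorem; rewrite /root pE scale0r addr0 g2q.
  have [||_ ->//] := @double_root_deriv _ F 1 r q y; first by rewrite hornerC oner_neq0.
  move=> t; rewrite hornerC mul1r FE -pE rE !linD !linZ.
  have [-> -> _] := frame_v fr; have [-> -> _] := frame_w fr.
  by rewrite !hornerE /=; ring.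
move=> v fv; rewrite LE GE; have := FE v; rewrite fv => /esym/eqP.
rewrite addr_eq0 => /eqP E.
rewrite mulrDr [g2 v * (lin b v * _)]mulrCA mulrA [lin b v * (_ * _)]mulrA.
have -> : g2 v * lin a v * h1 v + lin b v * g2 v * h2 v =
  lin a v * (g2 v * h1 v - g1 v * h2 v) + (lin b v * g2 v + lin a v * g1 v) * h2 v by ring.
by rewrite E addrN mul0r addr0; field.
Qed.

End LocalEquation.

(** * Regular functions on an affine plane curve *)

Section AffineExtension.
Variable K : numClosedFieldType.

Local Notation "P .[| x , y |]" := (P.[y%:P].[x]) (at level 2, format "P .[| x ,  y |]").

Variables (P : {poly {poly K}}) (A B : K -> K -> K).
Hypothesis P_monic : P \is monic.
Hypothesis P_size : (1 < size P)%N.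
Hypothesis local_quotient : forall x y, P.[| x, y |] = 0 -> exists H G : {poly {poly K}},
  H.[| x, y |] != 0 /\
  forall x' y', P.[| x', y' |] = 0 -> H.[| x', y' |] * A x' y' = G.[| x', y' |] * B x' y'.

(** [H] is a denominator of [A / B] on the curve; cross-multiplied because [B] may vanish. *)
Let quot (H : {poly {poly K}}) := exists G : {poly {poly K}},
  forall x y, P.[| x, y |] = 0 -> H.[| x, y |] * A x y = G.[| x, y |] * B x y.

Let quotD H1 H2 : quot H1 -> quot H2 -> quot (H1 + H2).
Proof.
move=> [G1 E1] [G2 E2]; exists (G1 + G2) => x y Pxy.
by rewrite !hornerD !mulrDl E1 ?E2.
Qed.

Let quotMl Q H : quot H -> quot (Q * H).
Proof.
by move=> [G E]; exists (Q * G) => x y Pxy; rewrite !hornerM -!mulrA E.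
Qed.

Let quot_congr H1 H2 :
  (forall x y, P.[| x, y |] = 0 -> H1.[| x, y |] = H2.[| x, y |]) -> quot H1 -> quot H2.
Proof. by move=> E [G GE]; exists G => x y Pxy; rewrite -E ?GE. Qed.

(** Avoidance on a finite set: [H + t Hc] is nonzero at all the listed points for all but finitely
    many [t]. *)
Let quot_fiber x (cs : seq K) : (forall c, c \in cs -> P.[| x, c |] = 0) ->
  exists2 H, quot H & forall c, c \in cs -> H.[| x, c |] != 0.
Proof.
elim: cs => [|c cs IH] Pc.
  by exists 0 => //; exists 0 => x' y' _; rewrite !horner0 !mul0r.
have [|H qH Hcs] := IH; first by move=> c' h; apply: Pc; rewrite inE h orbT.
have [Hc [Gc [Hcc E]]] := local_quotient (Pc c (mem_head _ _)).
pose p := \prod_(c' <- c :: cs) ((H.[| x, c' |])%:P + (Hc.[| x, c' |])%:P * 'X).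
have p0 : p != 0.
  rewrite prodf_seq_neq0; apply/allP => c' hc' /=; apply/eqP => E0.
  have := congr1 (fun r : {poly K} => r`_0) E0.
  have := congr1 (fun r : {poly K} => r`_1) E0.
  rewrite !coef0 !coefD !coefCM !coefX !coefC /= mulr0 mulr1 add0r addr0 => h1 h0.
  move: hc'; rewrite inE => /predU1P[E1|/Hcs]; last by rewrite h0 eqxx.
  by move: Hcc; rewrite -E1 h1 eqxx.
have [t /eqP pt] : exists t, p.[t] <> 0.
  by apply/existsNP => h; move: p0; rewrite (poly_eq0 h) eqxx.
exists (H + t%:P%:P * Hc).
  by apply: quotD => //; apply: quotMl; exists Gc.
move=> c' hc'; move: pt; rewrite horner_prod prodf_seq_neq0 => /allP/(_ c' hc') /=.
by rewrite !hornerE [t * _]mulrC.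
Qed.

(** A denominator without zeros on the fibre over [x] shares no root with [P] there, so their
    resultant is nonzero at [x]; lying in the ideal of the two, it is again a denominator. *)
Let quot_const x : exists2 h : {poly K}, quot h%:P & h.[x] != 0.
Proof.
have monx : spec x P \is monic by apply: monic_map.
have [rs rsE] := closed_field_poly_normal (spec x P).
have rootE c : (c \in rs) = (P.[| x, c |] == 0).
  rewrite -specE -[RHS]/(root (spec x P) c) rsE (monicP monx) scale1r.
  by rewrite root_prod_XsubC.
have [|H qH Hrs] := @quot_fiber x rs; first by move=> c; rewrite rootE => /eqP.
(* [H'] agrees with [H] on the curve. Adding [P] makes it monic, so that the resultant commutes with
   specialization. *)
pose H' := P + Pdiv.CommonRing.rmodp H P.
have szH : (size (Pdiv.CommonRing.rmodp H P) < size P)%N by rewrite Pdiv.CommonRing.ltn_rmodp monic_neq0.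
have HH' a c : P.[| a, c |] = 0 -> H'.[| a, c |] = H.[| a, c |].
  move=> Pac; rewrite [in RHS](Pdiv.RingMonic.rdivp_eq P_monic H) /H' !hornerE.
  by rewrite Pac mulr0 !add0r.
have H'mon : H' \is monic by rewrite monicE lead_coefDl // (monicP P_monic).
have H'size : (1 < size H')%N by rewrite size_polyDl.
clearbody H'.
exists (resultant P H').
  have [[U W] /= _ E] := resultant_in_ideal P_size H'size.
  apply: (@quot_congr (W * H)); last exact: quotMl.
  by move=> a c Pac; rewrite E !hornerE Pac mulr0 add0r HH'.
have -> : (resultant P H').[x] = resultant (spec x P) (spec x H').
  by rewrite /spec -map_resultant //= ?(monicP P_monic) ?(monicP H'mon) rmorph1 oner_eq0.
rewrite resultant_eq0 -leqNgt leqNgt; apply/negP => sz.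
have /closed_rootP[c] : size (gcdp (spec x P) (spec x H')) != 1%N.
  by rewrite neq_ltn sz orbT.
rewrite root_gcd => /andP[rP]; rewrite /root specE.
have /eqP Pc : P.[| x, c |] == 0 by rewrite -specE.
by rewrite HH' // => /eqP h; have := Hrs c; rewrite rootE Pc h !eqxx => /(_ isT).
Qed.

(* The denominators of A / B form an ideal of K[x][y].  Resultants with P give it,
   for every x, an element constant in y and non-zero at x, so the trace of the
   ideal on K[x] has no zero and is the unit ideal. *)
Lemma affine_extension : exists2 G : {poly {poly K}}, (size G < size P)%N &
  forall x y, P.[| x, y |] = 0 -> A x y = G.[| x, y |] * B x y.
Proof.
suff [G GE] : quot 1.
  exists (Pdiv.CommonRing.rmodp G P); first by rewrite Pdiv.CommonRing.ltn_rmodp monic_neq0.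
  move=> x y Pxy; have := GE x y Pxy; rewrite !hornerE => ->.
  rewrite {1}(Pdiv.RingMonic.rdivp_eq P_monic G) !hornerE Pxy.
  by rewrite mulr0 add0r.
(* A denominator in K[x] of least size is constant: at a root of it some other denominator is
   nonzero, and the remainder of that one would be smaller. *)
pose S k := `[< exists2 h : {poly K}, quot h%:P & h != 0 /\ size h = k >].
have exS : exists k, S k.
  have [h qh h0] := quot_const 0; exists (size h); apply/asboolP; exists h => //.
  by split=> //; apply: contraNneq h0 => ->; rewrite horner0.
case: (ex_minnP exS) => k /asboolP [h qh [h0 hk] ] kmin.
have [/eqP/size_poly1P[e e0 hE]|/closed_rootP[x /eqP hx]] := eqVneq (size h) 1%N.
  apply: (@quot_congr ((e^-1)%:P%:P * h%:P)); last exact: quotMl.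
  by move=> x y _; rewrite hE !hornerE mulVf.
have [g qg gx] := quot_const x.
have rE : g %% h = g - g %/ h * h by apply/eqP; rewrite eq_sym subr_eq addrC -divp_eq.
have : S (size (g %% h)).
  apply/asboolP; exists (g %% h).
    by rewrite rE -mulNr polyCD polyCM; apply: quotD => //; apply: quotMl.
  split=> //; apply: contraNneq gx => r0.
  by rewrite (divp_eq g h) r0 addr0 hornerM hx mulr0.
by move=> /kmin; rewrite leqNgt -hk ltn_modp h0.
Qed.

End AffineExtension.

(** * Regular sections of O(m) are forms *)

Section FrameKernel.
Variable K : fieldType.
Local Notation V := 'cV[K]_3.

(** Subtracting multiples of [k] moves two basis vectors into the line [r = 0], which is then
    parametrized by them. *)
Lemma frame_kernel (r : 'rV[K]_3) k : lin r k != 0 ->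
  exists u v a b, frame u v k a b ((lin r k)^-1 *: r).
Proof.
move=> rk; have k0 : k != 0 by apply: contraNneq rk => ->; rewrite lin0.
have [u [v [a [b [c fr]]]]] := frame_ex1 k0.
have rE y : lin r y = lin a y * lin r u + lin b y * lin r v + lin c y * lin r k.
  by rewrite {1}(frameE fr y) !linD !linZ.
exists (u - (lin r u / lin r k) *: k), (v - (lin r v / lin r k) *: k), a, b.
split=> [y|x y z].
  rewrite {1}(frameE fr y); apply/colP => i; rewrite linZl (rE y) !mxE; field.
  exact: rk.
have -> : x *: (u - (lin r u / lin r k) *: k) + y *: (v - (lin r v / lin r k) *: k) +
    z *: k = x *: u + y *: v + (z - x * (lin r u / lin r k) - y * (lin r v / lin r k)) *: k.
  by apply/colP => i; rewrite !mxE; ring.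
set s := z - _ - _; rewrite linZl (rE (_ + s *: k)).
have [-> -> ->] := frame_coord fr x y s.
by split=> //; rewrite /s; field.
Qed.

End FrameKernel.

Section Coefficients.
Variable K : numClosedFieldType.

Lemma fiberwise_eq0 n (A : set K) (R : {poly {poly K}}) : finite_set A ->
  (size R <= n)%N ->
  (forall x, ~ A x -> exists2 ys, uniq ys /\ size ys = n &
     forall y, y \in ys -> R.[y%:P].[x] = 0) -> R = 0.
Proof.
move=> fA sR H; apply/polyP => k; rewrite coef0.
apply: (poly_cofinite_eq0 fA) => x /H[ys [uys sys] R0].
suff : spec x R = 0 by move=> /polyP/(_ k); rewrite coef_map coef0.
apply: (@roots_geq_poly_eq0 _ _ ys) => //.
  by apply/allP => y /R0 Ry; rewrite /root specE Ry.
by rewrite sys; apply: leq_trans sR; apply: size_poly.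
Qed.

(* g and h are the coefficients of w^k of a section of O(m) in two charts
   exchanged by x -> 1/x. *)
Lemma reciprocal_coef (A : set K) (g h : {poly K}) k m : finite_set A ->
  (forall x, ~ A x -> x != 0 -> g.[x] * x ^+ k = x ^+ m * h.[x^-1]) ->
  (g != 0 -> (size g + k <= m.+1)%N) /\
  forall y, h.[y] = \sum_(j < size g) g`_j * y ^+ (m - k - j).
Proof.
(* [r] is [x ^ size h * h (1 / x)]; the exponent is one above the degree bound, so it makes sense
   for [h = 0] too. *)
move=> fA E; pose r := \sum_(j < size h) h`_j *: 'X^(size h - j).
have fA0 : finite_set (A `|` [set 0]) by rewrite finite_setU; split=> //; exact: finite_set1.
have sr : (size r <= (size h).+1)%N.
  apply: (leq_trans (size_sum _ _ _)); apply/bigmax_leqP => j _.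
  by apply: (leq_trans (size_scale_leq _ _)); rewrite size_polyXn ltnS leq_subr.
have rE x : x != 0 -> r.[x] = x ^+ size h * h.[x^-1].
  move=> x0; rewrite horner_sum horner_coef mulr_sumr; apply: eq_bigr => j _.
  rewrite hornerZ hornerXn mulrCA exprVn; congr (_ * _).
  by rewrite -exprB ?unitfE // ltnW.
have Epoly : 'X^(size h + k) * g = 'X^m * r.
  apply/eqP; rewrite -subr_eq0; apply/eqP/(poly_cofinite_eq0 fA0) => x /not_orP[Ax x0].
  have {}x0 : x != 0 by apply/eqP.
  rewrite !hornerE /= rE // exprD.
  transitivity (x ^+ size h * (g.[x] * x ^+ k - x ^+ m * h.[x^-1])); first by ring.
  by rewrite E // subrr mulr0.
have sg : g != 0 -> (size g + k <= m.+1)%N.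
  move=> g0; have := congr1 (fun p : {poly K} => size p) Epoly.
  rewrite /= !(mulrC 'X^_) size_mulXn // => s1.
  have : (size (r * 'X^m)%R <= m + (size h).+1)%N.
    have [->|r0] := eqVneq r 0; first by rewrite mul0r size_poly0.
    by rewrite size_mulXn // leq_add2l.
  by rewrite -s1; move: (size h) (size g) => s s2 hs; lia.
split=> // y; pose T := \sum_(j < size g) g`_j *: 'X^(m - k - j).
have TE t : T.[t] = \sum_(j < size g) g`_j * t ^+ (m - k - j).
  by rewrite horner_sum; apply: eq_bigr => j _; rewrite hornerZ hornerXn.
suff /eqP : h - T = 0 by rewrite -TE subr_eq0 => /eqP ->.
apply: (@poly_cofinite_eq0 _ (GRing.inv @` A `|` [set 0])).
  by rewrite finite_setU; split; [exact: finite_image|exact: finite_set1].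
move=> t /not_orP[At /= /eqP t0]; rewrite !hornerE TE.
have At' : ~ A t^-1 by move=> h'; apply: At; exists t^-1 => //; rewrite invrK.
have := E _ At'; rewrite invr_eq0 invrK => /(_ t0) E'.
have -> : h.[t] = t ^+ m * (g.[t^-1] * t^-1 ^+ k).
  by rewrite E' mulrA -exprMn divff // expr1n mul1r.
apply/eqP; rewrite subr_eq0 horner_coef mulr_suml mulr_sumr; apply/eqP/eq_bigr => j _.
have jk : (j + k <= m)%N.
  have g0 : g != 0 by rewrite -size_poly_gt0 (leq_ltn_trans _ (ltn_ord j)).
  by rewrite -ltnS; apply: leq_trans (sg g0); rewrite ltn_add2r.
have mE : m = (m - k - j + j + k)%N by lia.
rewrite {1}mE !exprD !exprVn; field.
by rewrite !expf_neq0.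
Qed.

End Coefficients.

(** * The curve as a set of points with chosen vectors *)

Section Curve.
Variables (K : numClosedFieldType) (n : nat) (F : {mpoly K[3]}).
Local Notation V := 'cV[K]_3.
Local Notation f := (mpeval F).
Local Notation D := (dir_deriv F).
Hypothesis hF : F \is n.-homog.
Hypothesis F_smooth : forall v, v != 0 -> f v = 0 -> exists y, D v y != 0.
Hypothesis n_gt1 : (1 < n)%N.

Variables (Z : choiceType) (e : Z -> V).
Hypothesis e_neq0 : forall z, e z != 0.
Hypothesis e_curve : forall z, f (e z) = 0.
Hypothesis e_inj : forall z z' c, e z = c *: e z' -> z = z'.
Hypothesis e_surj : forall v, v != 0 -> f v = 0 -> exists z c, v = c *: e z.

Let fF : form n f := form_mpeval hF.

Lemma point_choice (z0 : Z) : exists (zeta : V -> Z) (kappa : V -> K),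
  forall v, v != 0 -> f v = 0 -> v = kappa v *: e (zeta v) /\ kappa v != 0.
Proof.
have /boolp.choice[h hE] : forall v, exists zc : Z * K, v != 0 -> f v = 0 ->
    v = zc.2 *: e zc.1 /\ zc.2 != 0.
  move=> v; have [[v0 fv]|N] := EM (v != 0 /\ f v = 0); last first.
    by exists (z0, 1) => v0 fv; exfalso; apply: N.
  have [z [c E]] := e_surj v0 fv; exists (z, c) => _ _; split=> //=.
  by apply: contraNneq v0 => c0; rewrite E c0 scale0r.
by exists (fun v => (h v).1), (fun v => (h v).2).
Qed.

Lemma line_finite r k : lin r k != 0 -> finite_set [set z | lin r (e z) = 0].
Proof.
have [[z0]|NZ] := EM (exists z0 : Z, True); last first.
  by move=> _; apply: (sub_finite_set _ (finite_set0 Z)) => z; case: NZ; exists z.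
move=> _ rk; have [zeta [kappa zE]] := point_choice z0.
have [u [v [a [b fr]]]] := frame_kernel rk.
have fS := pencil_leading_finite hF F_smooth n_gt1 fr.
apply: (sub_finite_set (B := [set zeta v] `|`
  (fun x => zeta (u + x *: v)) @` [set x | f (u + x *: v) = 0])); last first.
  by rewrite finite_setU; split; [exact: finite_set1|exact: finite_image].
move=> z /= rz.
have ez : e z = lin a (e z) *: u + lin b (e z) *: v.
  by rewrite {1}(frameE fr (e z)) linZl rz mulr0 scale0r addr0.
have key y c : e z = c *: y -> z = zeta y.
  move=> E; have c0 : c != 0.
    by apply: contraNneq (e_neq0 z) => c0; rewrite E c0 scale0r.
  have [|| yE _] := zE y.
  - by apply: contraNneq (e_neq0 z) => y0; rewrite E y0 scaler0.
  - by apply/eqP; have /eqP := e_curve z;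
      rewrite E (form_homog _ _ fF) mulf_eq0 expf_eq0 (negPf c0) andbF.
  by apply: (@e_inj _ _ (c * kappa y)); rewrite -scalerA -yE.
have [a0|a0] := eqVneq (lin a (e z)) 0.
  left; apply: (key _ (lin b (e z))).
  by rewrite {1}ez a0 scale0r add0r.
right; have zE' : e z = lin a (e z) *: (u + (lin b (e z) / lin a (e z)) *: v).
  by rewrite scalerDr scalerA mulrCA divff // mulr1.
exists (lin b (e z) / lin a (e z)); last by rewrite -(key _ _ zE').
by apply/eqP; have /eqP := e_curve z;
  rewrite {1}zE' (form_homog _ _ fF) mulf_eq0 expf_eq0 (negPf a0) andbF.
Qed.

(** Projection from [w] off the curve makes the affine equation monic. Such a [w] lies on any line
    through [e z] along which [f] has a nonzero derivative. *)
Lemma noncurve_frame z : exists v w a b c, frame (e z) v w a b c /\ f w != 0.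
Proof.
have [y Dy] := F_smooth (e_neq0 z) (e_curve z).
have [t ft] : exists t, f (e z + t *: y) != 0.
  apply: contrapT => /forallNP h; move/eqP: Dy; apply; apply: deriv_along_zero => t.
  by apply/eqP/negPn/negP/h.
set w := e z + t *: y in ft.
have w0 : w != 0.
  apply: contraNneq ft => w0; rewrite w0 -(scale0r (e z)) (form_homog _ _ fF).
  by rewrite e_curve mulr0.
have [|u [a [b [c fr]]]] := @frame_ex2 _ (e z) w.
  apply: indepP => // s E; have := e_curve z.
  rewrite E (form_homog _ _ fF) => /eqP; rewrite mulf_eq0 (negPf ft) orbF expf_eq0.
  by case/andP => _ /eqP s0; have := e_neq0 z; rewrite E s0 scale0r eqxx.
by exists u, w, b, a, c; split=> //; apply: frame_swap.
Qed.

Section Chart.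
Variables (u v w : V) (a b c : 'rV[K]_3).
Hypothesis fr : frame u v w a b c.
Hypothesis fw : f w != 0.

Lemma chart_coord x y : lin a (u + x *: v + y *: w) = 1 /\
  lin b (u + x *: v + y *: w) = x.
Proof. by have := frame_coord fr 1 x y; rewrite scale1r => -[]. Qed.

Lemma chart_neq0 x y : u + x *: v + y *: w != 0.
Proof.
by apply/eqP => E; have [/eqP] := chart_coord x y; rewrite E lin0 eq_sym oner_eq0.
Qed.

(** Fibres of the projection are line sections through [w]. Parameter [t] of the pencil is
    [y = 1 / t] in the chart, with [t != 0] since [w] is off the curve. *)
Lemma fiber_cofinite (S : set Z) : finite_set S ->
  exists2 A : set K, finite_set A & forall x, ~ A x ->
    exists ys, [/\ uniq ys, size ys = n &
      forall y, y \in ys -> f (u + x *: v + y *: w) = 0 /\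
        forall z s, u + x *: v + y *: w = s *: e z -> ~ S z].
Proof.
move=> fS; pose slope z := lin b (e z) / lin a (e z).
exists ([set x | ~ exists ts, transversal_section n F w (u + x *: v) ts] `|` slope @` S).
  rewrite finite_setU; split; last exact: finite_image.
  exact: transversal_cofinite fr.
move=> x /not_orP[/= Nx Sx]; have [ts [fy uts sts tsE _]] := contrapT Nx.
exists (map GRing.inv ts); split; [|by rewrite size_map|].
  by rewrite map_inj_uniq //; exact: invr_inj.
move=> _ /mapP[t tts ->].
have t0 : t != 0.
  by apply: contraNneq fw => t0; move: tts; rewrite tsE t0 scale0r addr0.
have E : u + x *: v + t^-1 *: w = t^-1 *: (w + t *: (u + x *: v)).
  by rewrite scalerDr scalerA mulVf // scale1r addrC.
split; first by rewrite E (form_homog _ _ fF); move: tts; rewrite tsE => /eqP ->; rewrite mulr0.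
move=> z s Ez Sz; apply: Sx; exists z => //.
have [] := chart_coord x t^-1; rewrite Ez !linZ => a1 bx.
have s0 : s != 0.
  by apply/eqP => s0; move/eqP: a1; rewrite s0 mul0r eq_sym oner_eq0.
by rewrite -bx /slope -[RHS]divr1 -a1 -mulf_div divff // mul1r.
Qed.

Lemma chart_poly d g : form d g -> exists P : {poly {poly K}},
  forall x y, P.[y%:P].[x] = g (u + x *: v + y *: w).
Proof.
move=> hg; apply: (poly2_form hg) => i.
apply: (@poly2_ext _ (fun x y => (u i 0 + x * v i 0) + y * w i 0)).
  by move=> x y; rewrite !mxE.
apply: poly2D; last by apply: poly2M; [exact: poly2_snd|exact: poly2_cst].
apply: poly2D; first exact: poly2_cst.
by apply: poly2M; [exact: poly2_fst|exact: poly2_cst].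
Qed.

Lemma chart_equation : exists P : {poly {poly K}},
  [/\ P \is monic, size P = n.+1 &
   forall x y, (P.[y%:P].[x] = 0) <-> (f (u + x *: v + y *: w) = 0)].
Proof.
have [P PE] := chart_poly fF.
have spP x : (size (spec x P) <= n.+1)%N /\ (spec x P)`_n = f w.
  have [p [sp pn pE]] := form_line (u + x *: v) w fF.
  suff -> : spec x P = p by [].
  by apply/eqP; rewrite -subr_eq0; apply/eqP/poly_eq0 => t; rewrite !hornerE specE PE pE subrr.
have Pn : P`_n = (f w)%:P.
  apply/eqP; rewrite -subr_eq0; apply/eqP/poly_eq0 => x; rewrite !hornerE.
  by have [_ <-] := spP x; rewrite coef_map subrr.
have sP : (size P <= n.+1)%N.
  apply/leq_sizeP => k nk; apply: poly_eq0 => x; have [sx _] := spP x.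
  by have := nth_default 0 (leq_trans sx nk); rewrite coef_map.
have {}sP : size P = n.+1.
  apply/eqP; rewrite eqn_leq sP ltnNge; apply/negP => /leq_sizeP/(_ n (leqnn n)).
  by rewrite Pn => /eqP; rewrite polyC_eq0 (negPf fw).
exists ((f w)^-1%:P%:P * P); split.
- rewrite monicE lead_coefM lead_coefC lead_coefE sP Pn -polyCM mulVf //.
- by rewrite mul_polyC size_scale // polyC_eq0 invr_eq0.
move=> x y; rewrite !hornerE PE; split=> [/eqP|->]; last by rewrite mulr0.
by rewrite mulf_eq0 invr_eq0 (negPf fw) => /eqP.
Qed.

End Chart.

(** The curve has no isolated points: modulo the chart equation, [g] has a remainder of degree below
    n that vanishes at n points of almost every fibre. *)
Lemma form_vanish_closure d g : form d g ->
  finite_set [set z | g (e z) <> 0] -> forall z, g (e z) = 0.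
Proof.
move=> hg fS z; have [v [w [a [b [c [fr fw]]]]]] := noncurve_frame z.
have [P [Pmon sP PE]] := chart_equation (e z) v fw.
have [Q QE] := chart_poly (e z) v w hg.
have [A fA hA] := fiber_cofinite fr fw fS.
have R0 : Pdiv.CommonRing.rmodp Q P = 0.
  apply: (@fiberwise_eq0 _ n A) => //.
    by rewrite -ltnS -sP Pdiv.CommonRing.ltn_rmodp monic_neq0.
  move=> x /hA[ys [uys sys ysE]]; exists ys => // y /ysE[fy Sy].
  have [z' [s E]] := e_surj (chart_neq0 fr x y) fy.
  have := Sy _ _ E => /contrapT gz.
  have : Q.[y%:P].[x] = 0 by rewrite QE E (form_homog _ _ hg) gz mulr0.
  rewrite {1}(Pdiv.RingMonic.rdivp_eq Pmon Q) !hornerE (PE x y).2 //.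
  by rewrite mulr0 add0r.
have := QE 0 0; rewrite !scale0r !addr0 => <-.
rewrite (Pdiv.RingMonic.rdivp_eq Pmon Q) R0 addr0 !hornerE (PE 0 0).2 ?mulr0 //.
by rewrite !scale0r !addr0.
Qed.

Section SectionExtension.
Variables (m : nat) (A B : Z -> K).
Hypothesis local_quotient : forall z0, exists d phi psi,
  [/\ form d phi, form (d + m) psi, phi (e z0) != 0 &
      forall z, phi (e z) * A z = psi (e z) * B z].
Hypothesis B_finite : finite_set [set z | B z = 0].

(** The factor [s ^ m] compares the vector in the chart with the chosen vector of the same point. *)
Let chart_extension u v w a b c : frame u v w a b c -> f w != 0 -> forall z0 : Z,
  exists2 G : {poly {poly K}}, (size G <= n)%N &
    forall x y z s, u + x *: v + y *: w = s *: e z ->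
      s ^+ m * A z = G.[y%:P].[x] * B z.
Proof.
move=> fr fw z0; have [zeta [kappa zE]] := point_choice z0.
have [P [Pmon sP PE]] := chart_equation u v fw.
pose p x y := u + x *: v + y *: w.
have p0 x y : p x y != 0 := chart_neq0 fr x y.
pose AA x y := kappa (p x y) ^+ m * A (zeta (p x y)).
pose BB x y := B (zeta (p x y)).
have [|x y /PE fp|G sG GE] := @affine_extension K P AA BB Pmon.
- by rewrite sP ltnS ltnW.
- have [pE k0] := zE _ (p0 x y) fp.
  have [d [phi [psi [hphi hpsi phi0 E]]]] := local_quotient (zeta (p x y)).
  have [H HE] := chart_poly u v w hphi; have [G GE] := chart_poly u v w hpsi.
  exists H, G; split.
    by rewrite HE -/(p x y) pE (form_homog _ _ hphi) mulf_neq0 // expf_neq0.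
  move=> x' y' /PE fp'; have [pE' k0'] := zE _ (p0 x' y') fp'.
  rewrite HE GE -/(p x' y') {1 2}pE' (form_homog _ _ hphi) (form_homog _ _ hpsi).
  by rewrite /AA /BB exprD mulrACA E !mulrA.
exists G => [|x y z s E]; first by rewrite -ltnS -sP.
have fp : f (p x y) = 0 by rewrite /p E (form_homog _ _ fF) e_curve mulr0.
have := GE x y; rewrite /AA /BB => /(_ ((PE x y).2 fp)).
have [pE k0] := zE _ (p0 x y) fp.
have zz : zeta (p x y) = z.
  apply: (@e_inj _ _ ((kappa (p x y))^-1 * s)).
  by rewrite -scalerA -E -/(p x y) {3}pE scalerA mulVf // scale1r.
suff -> : kappa (p x y) = s by rewrite zz.
apply/eqP; rewrite -subr_eq0; have /eqP : (kappa (p x y) - s) *: e z = 0.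
  by rewrite scalerBl -E -/(p x y) {2}pE zz subrr.
by rewrite scaler_eq0 (negPf (e_neq0 z)) orbF.
Qed.

(** The charts [a = 1] and [b = 1] cover the curve, as [a = b = 0] only at [w]. The coefficient of
    [y ^ k] is a section of O(m - k) on P^1; gluing bounds its degree, which permits
    homogenization. *)
Lemma section_extension : exists2 G, form m G & forall z, A z = G (e z) * B z.
Proof.
have [[z0]|NZ] := EM (exists z0 : Z, True); last first.
  by exists (fun=> 0) => [|z]; [exact: form0|exfalso; apply: NZ; exists z].
move=> _; have [v [w [a [b [c [fr fw]]]]]] := noncurve_frame z0.
move: (e z0) fr => u fr.
have [G sG GE] := chart_extension fr fw z0.
have [H sH HE] := chart_extension (frame_swap fr) fw z0.
have [S fS hS] := fiber_cofinite fr fw B_finite.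
have GH k x : ~ S x -> x != 0 -> (G`_k).[x] * x ^+ k = x ^+ m * (H`_k).[x^-1].
  move=> /hS[ys [uys sys ysE]] x0.
  (* [H] rewritten in the first chart, whose point (x, y) has coordinates (1 / x, y / x) in the
     second; n points of a fibre force equality. *)
  pose T := \poly_(j < n) (x ^+ m * (H`_j).[x^-1] * x ^- j).
  have GT : spec x G - T = 0.
    apply: (@roots_geq_poly_eq0 _ _ ys) => //.
    - apply/allP => y /ysE[fy By]; rewrite /root !hornerE subr_eq0 specE.
      have [z [s E]] := e_surj (chart_neq0 fr x y) fy.
      have Bz : B z != 0 by apply/eqP; apply: (By z s E).
      have E' : v + x^-1 *: u + (y / x) *: w = (s / x) *: e z.
        rewrite [s / x]mulrC -(scalerA x^-1 s) -E; apply/colP => i; rewrite !mxE; field.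
        exact: x0.
      have Ey : T.[y] = x ^+ m * H.[(y / x)%:P].[x^-1].
        rewrite horner_poly (horner_coef_wide _ sH) horner_sum mulr_sumr.
        apply: eq_bigr => j _; rewrite !hornerE /= ?horner_exp ?hornerC exprMn exprVn; ring.
      apply/eqP/(mulIf Bz); rewrite -(GE _ _ _ _ E) Ey -mulrA -(HE _ _ _ _ E').
      by rewrite mulrA -exprMn mulrCA divff // mulr1.
    - rewrite sys; apply: (leq_trans (size_polyD _ _)); rewrite size_polyN geq_max.
      by rewrite size_poly (leq_trans (size_poly _ _)).
  have /polyP/(_ k) : spec x G = T by apply/eqP; rewrite -subr_eq0 GT.
  rewrite coef_map coef_poly /= /horner_eval => ->; case: ltnP => kn.
    by rewrite mulfVK // expf_neq0.
  by rewrite nth_default ?(leq_trans sH) // horner0 mul0r mulr0.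
have deg k := reciprocal_coef fS (GH k).
have jk k (j : 'I_(size G`_k)) : (j + k <= m)%N.
  have g0 : G`_k != 0 by rewrite -size_poly_gt0 (leq_ltn_trans _ (ltn_ord j)).
  by rewrite -ltnS; apply: leq_trans ((deg k).1 g0); rewrite ltn_add2r.
have mE p q : (p + q <= m)%N -> m = (m - q - p + p + q)%N by lia.
(* The homogenization of [G]; the truncated subtractions are exact by [jk]. *)
exists (fun p => \sum_(k < n) \sum_(j < size G`_k)
    G`_k`_j * (lin a p ^+ (m - k - j) * lin b p ^+ j * lin c p ^+ k)).
  apply: form_sum => k _; apply: form_sum => j _; apply: formZ.
  have -> : m = (1 * (m - k - j) + 1 * j + 1 * k)%N by have := jk k j; lia.
  have -> : (1 * (m - k - j) + 1 * j + 1 * k - k - j)%N = (m - k - j)%N.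
    by have := jk k j; lia.
  by apply: formM; first apply: formM; apply/formX/form_lin.
move=> z; have ez := frameE fr (e z).
move: (lin a _) (lin b _) (lin c _) ez => al be ga ez.
(* Points with [a = 0] are seen only by the second chart, over 0, where just the terms with
   [m - k - j = 0] survive. *)
have [al0|al0] := eqVneq al 0.
  have be0 : be != 0.
    apply/eqP => be0; have := e_neq0 z; have := e_curve z.
    rewrite ez al0 be0 !scale0r !add0r (form_homog _ _ fF) => /eqP.
    rewrite mulf_eq0 (negPf fw) orbF expf_eq0 => /andP[_ /eqP ->].
    by rewrite scale0r eqxx.
  have E : v + 0 *: u + (ga / be) *: w = be^-1 *: e z.
    rewrite ez al0; apply/colP => i; rewrite !mxE; field; exact: be0.
  have -> : A z = be ^+ m * H.[(ga / be)%:P].[0] * B z.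
    by rewrite -mulrA -(HE _ _ _ _ E) mulrA -exprMn divff // expr1n mul1r.
  congr (_ * _); rewrite (horner_coef_wide _ sH) horner_sum mulr_sumr.
  apply: eq_bigr => k _; rewrite !hornerE /= ?horner_exp ?hornerC (deg k).2.
  rewrite -mulrA mulr_suml mulr_sumr; apply: eq_bigr => j _.
  rewrite al0; have mE' := mE _ _ (jk k j).
  move: (m - k - j)%N mE' => [|l] ->; last by rewrite expr0n /= !(mul0r, mulr0).
  by rewrite !expr0 add0n exprD exprMn exprVn; field; rewrite !expf_neq0.
have E : u + (be / al) *: v + (ga / al) *: w = al^-1 *: e z.
  rewrite ez; apply/colP => i; rewrite !mxE; field; exact: al0.
have -> : A z = al ^+ m * G.[(ga / al)%:P].[be / al] * B z.
  by rewrite -mulrA -(GE _ _ _ _ E) mulrA -exprMn divff // expr1n mul1r.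
congr (_ * _); rewrite (horner_coef_wide _ sG) horner_sum mulr_sumr.
apply: eq_bigr => k _; rewrite !hornerE /= ?horner_exp ?hornerC horner_coef.
rewrite -mulrA mulr_suml mulr_sumr; apply: eq_bigr => j _.
by rewrite {1}(mE _ _ (jk k j)) !exprD !exprMn !exprVn; field; rewrite !expf_neq0.
Qed.

End SectionExtension.

(** * Pulling back line sections *)

(** All intersections are simple, stated in the form that makes [L] a local parameter at each of
    them. *)
Definition transversal (L : 'rV[K]_3) : Prop :=
  (exists k, lin L k != 0) /\
  forall z, lin L (e z) = 0 -> exists y, lin L y = 0 /\ D (e z) y != 0.

(** All that is retained of the sheaf structure: quotients of degree 0 pull back to local quotients.
    The locus [phi != 0] serves as the neighbourhood of [z0]. *)
Definition pulls_back (mu : Z -> Z) : Prop := forall d A B z0,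
  form d A -> form d B -> B (e (mu z0)) != 0 -> exists d' phi psi,
  [/\ form d' phi, form d' psi, phi (e z0) != 0 &
   forall z, phi (e z) != 0 -> B (e (mu z)) != 0 /\
     A (e (mu z)) * phi (e z) = B (e (mu z)) * psi (e z)].

(** A transversal section has at least two points, which span its line; so [r] vanishes on almost
    all lines of a pencil. *)
Lemma curve_spans r (z0 : Z) : (forall z, lin r (e z) = 0) -> forall k, lin r k = 0.
Proof.
move=> r0 k; have [v [w [a [b [c [fr fw]]]]]] := noncurve_frame z0.
move: (e z0) fr => u fr.
have fA := transversal_cofinite hF F_smooth n_gt1 fr.
have key x : (exists ts, transversal_section n F w (u + x *: v) ts) ->
    lin r w = 0 /\ lin r (u + x *: v) = 0.
  move=> [[|t [|t' ts]] [_ uts sts tsE _]].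
  - by move: n_gt1; rewrite -sts.
  - by move: n_gt1; rewrite -sts.
  have rt s : s \in [:: t, t' & ts] -> lin r w + s * lin r (u + x *: v) = 0.
    rewrite tsE => /eqP fs; have s0 : w + s *: (u + x *: v) != 0.
      apply/eqP => E; have [_ _] := frame_coord fr s (s * x) 1.
      by rewrite -scalerA -scalerDr addrC scale1r E lin0 => /eqP; rewrite eq_sym oner_eq0.
    by have [z [k' E]] := e_surj s0 fs; rewrite -linZ -linD E linZ r0 mulr0.
  have r1 := rt t (mem_head _ _).
  have r2 : lin r w + t' * lin r (u + x *: v) = 0 by apply: rt; rewrite !inE eqxx orbT.
  have /eqP : (t - t') * lin r (u + x *: v) = 0.
    by rewrite mulrBl -[t * _](addKr (lin r w)) r1 -[t' * _](addKr (lin r w)) r2 subrr.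
  rewrite mulf_eq0 subr_eq0; case: eqVneq uts => [->|_ _ /= /eqP r3].
    by rewrite /= !inE eqxx.
  by move: r1; rewrite r3 mulr0 addr0.
have p0 : (lin r u)%:P + (lin r v)%:P * 'X = 0.
  apply: (poly_cofinite_eq0 fA) => x /contrapT/key[_].
  by rewrite linD linZ !hornerE mulrC.
have [x /contrapT/key[rw _]] := cofinite_ex fA.
have := congr1 (fun q : {poly K} => q`_0) p0; have := congr1 (fun q : {poly K} => q`_1) p0.
rewrite /= !coef0 !coefD !coefCM !coefX !coefC /= mulr0 mulr1 add0r addr0 => rv ru.
by rewrite (frameE fr k) !linD !linZ rw rv ru !mulr0 !addr0.
Qed.

Lemma lin_neq0 (y : V) : y != 0 -> exists r, lin r y != 0.
Proof.
move=> /cV0Pn[j yj]; exists (delta_mx 0 j).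
by rewrite lin_delta.
Qed.

Section SectionLine.
Variables (u v w : V) (a b c : 'rV[K]_3) (x : K) (ts : seq K).
Hypothesis fr : frame u v w a b c.
Hypothesis sec : transversal_section n F w (u + x *: v) ts.

Lemma section_row y : lin (b - x *: a) y = lin b y - x * lin a y.
Proof. by rewrite -scaleNr linDl linZl mulNr. Qed.

Lemma section_point_coord t : [/\ lin a (w + t *: (u + x *: v)) = t,
  lin b (w + t *: (u + x *: v)) = t * x & lin c (w + t *: (u + x *: v)) = 1].
Proof.
have -> : w + t *: (u + x *: v) = t *: u + (t * x) *: v + 1 *: w.
  by apply/colP => i; rewrite !mxE; ring.
exact: frame_coord fr _ _ _.
Qed.

Lemma section_point_neq0 t : w + t *: (u + x *: v) != 0.
Proof.
apply/eqP => E; have [_ _ /eqP] := section_point_coord t.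
by rewrite E lin0 eq_sym oner_eq0.
Qed.

Lemma section_points z : lin (b - x *: a) (e z) = 0 ->
  exists s t, [/\ s != 0, t \in ts & e z = s *: (w + t *: (u + x *: v))].
Proof.
have [fy _ _ tsE _] := sec.
rewrite section_row => /eqP; rewrite subr_eq0 => /eqP bE.
have ez : e z = lin a (e z) *: (u + x *: v) + lin c (e z) *: w.
  by rewrite {1}(frameE fr (e z)) bE scalerDr scalerA [x * _]mulrC.
have fz := e_curve z.
have c0 : lin c (e z) != 0.
  apply/eqP => c0; move: fz; rewrite ez c0 scale0r addr0 (form_homog _ _ fF) => /eqP.
  rewrite mulf_eq0 (negPf fy) orbF expf_eq0 => /andP[_ /eqP a0].
  by have := e_neq0 z; rewrite ez a0 c0 !scale0r addr0 eqxx.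
have ezs : e z = lin c (e z) *: (w + (lin a (e z) / lin c (e z)) *: (u + x *: v)).
  by rewrite scalerDr scalerA mulrCA divff // mulr1 addrC.
exists (lin c (e z)), (lin a (e z) / lin c (e z)); split=> //.
rewrite tsE; move/eqP: fz; rewrite {1}ezs (form_homog _ _ fF) mulf_eq0 expf_eq0.
by rewrite (negPf c0) andbF.
Qed.

Lemma section_transversal : transversal (b - x *: a).
Proof.
split; first by exists v; rewrite section_row; have [-> -> _] := frame_v fr;
  rewrite mulr0 subr0 oner_eq0.
move=> z /section_points[s [t [s0 tts ->]]]; exists (u + x *: v); split.
  rewrite section_row !linD !linZ.
  have [-> -> _] := frame_v fr; have [-> -> _] := frame_u fr.
  by rewrite mulr0 addr0 mulr1 add0r subrr.
have [_ _ _ _ D0] := sec.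
by rewrite (form_homog _ _ (form_dir_deriv hF _)) mulf_neq0 ?expf_neq0 // D0.
Qed.

End SectionLine.

Section Automorphism.
Variables gamma delta : Z -> Z.
Hypothesis gammaK : cancel gamma delta.
Hypothesis deltaK : cancel delta gamma.
Hypothesis gamma_regular : pulls_back gamma.
Hypothesis delta_regular : pulls_back delta.

Definition has_quotient m (E : V -> K) (L1 L : 'rV[K]_3) z0 : Prop :=
  exists d phi psi, [/\ form d phi, form (d + m) psi, phi (e z0) != 0 &
    forall z, phi (e z) * (E (e z) * lin L1 (e (gamma z))) =
      psi (e z) * lin L (e (gamma z))].

(** One more factor [phi] on both sides makes the relation trivial wherever [phi] vanishes. *)
Lemma has_quotient_intro m E L1 L z0 d phi psi :
  form d phi -> form (d + m) psi -> phi (e z0) != 0 ->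
  (forall z, phi (e z) != 0 -> phi (e z) * (E (e z) * lin L1 (e (gamma z))) =
    psi (e z) * lin L (e (gamma z))) -> has_quotient m E L1 L z0.
Proof.
move=> hphi hpsi phi0 H.
exists (d + d)%N, (fun p => phi p * phi p), (fun p => phi p * psi p); split.
- exact: formM.
- by rewrite -addnA; apply: formM.
- by rewrite mulf_neq0.
move=> z; have [->|h] := eqVneq (phi (e z)) 0; first by rewrite !mul0r.
by rewrite -!mulrA H.
Qed.

Lemma has_quotient_regular m E L1 L z0 d A B : form m E ->
  form d A -> form d B -> B (e (gamma z0)) != 0 ->
  (forall z, B (e z) * lin L1 (e z) = lin L (e z) * A (e z)) ->
  has_quotient m E L1 L z0.
Proof.
move=> hE hA hB Bz0 H.
have [d' [phi [psi [hphi hpsi phi0 hq]]]] := gamma_regular hA hB Bz0.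
apply: (has_quotient_intro hphi (formM hpsi hE) phi0) => z /hq[B0 AB].
apply: (mulfI B0); have := H (gamma z).
move: AB; move: (lin L1 _) (lin L _) (A _) (B _) (E _) => l1 l x y ee AB H'.
transitivity (phi (e z) * ee * (y * l1)); first by ring.
rewrite H'; transitivity (ee * l * (x * phi (e z))); first by ring.
by rewrite AB; ring.
Qed.

Lemma has_quotient_away m E L1 L z0 : form m E -> lin L (e (gamma z0)) != 0 ->
  has_quotient m E L1 L z0.
Proof.
move=> hE Lz; apply: (has_quotient_regular hE (form_lin L1) (form_lin L) Lz) => z.
by rewrite mulrC.
Qed.

(** No pole arises at a common zero: [L] is a local parameter there and [L1] a multiple of it. *)
Lemma has_quotient_common_zero m E L1 L z0 : form m E -> transversal L ->
  lin L (e (gamma z0)) = 0 -> lin L1 (e (gamma z0)) = 0 -> has_quotient m E L1 L z0.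
Proof.
move=> hE [[k Lk] tL] Lz L1z; have [y [Ly Dy]] := tL _ Lz.
have [b [c [hb hc bq bc]]] := transversal_uniformizer hF (ltnW n_gt1) (e_neq0 _) Lz Ly Lk
  (e_curve _) Dy (form_lin L1) L1z.
rewrite addn0 in hc; apply: (has_quotient_regular hE hc hb bq) => z.
exact/bc/e_curve.
Qed.

(* E / L(gamma) is regular at z0: transported to gamma z0 by delta, E becomes a
   regular function vanishing there, hence a multiple of the uniformizer L. *)
Lemma has_quotient_zero m E L1 L z0 : form m E -> transversal L ->
  lin L (e (gamma z0)) = 0 -> E (e z0) = 0 -> has_quotient m E L1 L z0.
Proof.
move=> hE [[k Lk] tL] Lz Ez; have [y [Ly Dy]] := tL _ Lz.
(* Auxiliary lines avoiding [z0] and its image: they equalize degrees in the quotients to be pulled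
   back. *)
have [N' N'z] := lin_neq0 (e_neq0 z0).
have [N Nz] := lin_neq0 (e_neq0 (gamma z0)).
have hN'm : form m (fun p => lin N' p ^+ m).
  by have := formX m (form_lin N'); rewrite mul1n.
have N'm0 : lin N' (e (delta (gamma z0))) ^+ m != 0 by rewrite gammaK expf_neq0.
have [d [H [G [hH hG Hq HG]]]] := delta_regular hE hN'm N'm0.
have Gq : G (e (gamma z0)) = 0.
  have [_ /eqP] := HG _ Hq; rewrite gammaK Ez mul0r eq_sym mulf_eq0.
  by rewrite expf_eq0 (negPf N'z) andbF => /eqP.
(* [G] may have degree 0, while the division by the local parameter needs positive degree; hence the
   factor [N]. *)
have hNG : form d.+1 (fun p => lin N p * G p) by rewrite -add1n; exact: formM (form_lin N) hG.
have NGq : lin N (e (gamma z0)) * G (e (gamma z0)) = 0 by rewrite Gq mulr0.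
have [b [c [hb hc bq bc]]] := transversal_uniformizer hF (ltnW n_gt1) (e_neq0 _) Lz Ly Lk
  (e_curve _) Dy hNG NGq.
have hB : form (n.-1 + d + 1) (fun p => b p * H p * lin N p).
  by apply: formM (form_lin N); apply: formM.
have hA : form (n.-1 + d + 1) (fun p => c p * lin N p) by apply: formM (form_lin N).
have [|d1 [phi1 [psi1 [hphi1 hpsi1 phi10 hq1]]]] := gamma_regular hA hB (z0 := z0).
  by rewrite !mulf_neq0.
have [d2 [phi2 [psi2 [hphi2 hpsi2 phi20 hq2]]]] :=
  gamma_regular (form_lin L1) (form_lin N) Nz.
(* The section becomes [N' ^ m] times the pull-backs of [c N / (b H N)] and [L1 / N]. *)
apply: (@has_quotient_intro m E L1 L z0 (d1 + d2)%N (fun p => phi1 p * phi2 p)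
  (fun p => psi1 p * psi2 p * lin N' p ^+ m)).
- exact: formM.
- by apply: formM => //; apply: formM.
- by rewrite mulf_neq0.
move=> z; rewrite mulf_eq0 => /norP[/hq1[bHN0 E1] /hq2[_ E2]].
have Hz : H (e (gamma z)) != 0 by move: bHN0; rewrite !mulf_eq0 !negb_or => /andP[/andP[]].
have := bc _ (e_curve (gamma z)); have [_] := HG _ Hz; rewrite gammaK.
move: E1 E2 bHN0; move: (b _) (H _) (lin N _) (c _) (G _) (lin L _) (lin L1 _) (E _).
move: (phi1 _) (phi2 _) (psi1 _) (psi2 _) (lin N' _ ^+ m).
move=> p1 p2 s1 s2 nm b' h' n' c' g' l' l1' ee E1 E2 bHN0 E3 E4.
apply: (mulfI bHN0).
transitivity (b' * (ee * h') * n' * p1 * (l1' * p2)); first by ring.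
rewrite E2 E3; transitivity (nm * (b' * (n' * g')) * p1 * n' * s2); first by ring.
rewrite E4; transitivity (nm * l' * s2 * (c' * n' * p1)); first by ring.
by rewrite E1; ring.
Qed.

Lemma section_finite L : (exists k, lin L k != 0) ->
  finite_set [set z | lin L (e (gamma z)) = 0].
Proof.
move=> [k Lk]; apply: (sub_finite_set _ (finite_image delta (line_finite Lk))) => z /= Lz.
by exists (gamma z).
Qed.

Lemma quotient_form m E L1 L : form m E -> transversal L ->
  (forall z, lin L (e (gamma z)) = 0 -> E (e z) = 0 \/ lin L1 (e (gamma z)) = 0) ->
  exists2 B, form m B &
    forall z, E (e z) * lin L1 (e (gamma z)) = B (e z) * lin L (e (gamma z)).
Proof.
move=> hE tL H; apply: (@section_extension m (fun z => E (e z) * lin L1 (e (gamma z)))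
  (fun z => lin L (e (gamma z)))); last exact: section_finite tL.1.
move=> z; have [Lz|Lz] := eqVneq (lin L (e (gamma z))) 0; last exact: has_quotient_away.
by have [Ez|L1z] := H z Lz; [exact: has_quotient_zero|exact: has_quotient_common_zero].
Qed.

(** [E1] alone cancels the pole, so [E2] leaves a zero: [phi B = psi E2] holds off finitely many
    points, hence everywhere. *)
Lemma quotient_form_vanish m1 m2 E1 E2 B L1 L z0 : transversal L ->
  form m2 E2 -> form (m1 + m2) B ->
  (forall z, E1 (e z) * E2 (e z) * lin L1 (e (gamma z)) = B (e z) * lin L (e (gamma z))) ->
  has_quotient m1 E1 L1 L z0 -> E2 (e z0) = 0 -> B (e z0) = 0.
Proof.
move=> tL hE2 hB HB [d [phi [psi [hphi hpsi phi0 H]]]] E2z.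
have hX : form (d + (m1 + m2)) (fun p => phi p * B p - psi p * E2 p).
  by apply: formB; [exact: formM|rewrite addnA; exact: formM].
have := form_vanish_closure hX _ z0; rewrite E2z mulr0 subr0 => /(_ _)/eqP.
rewrite mulf_eq0 (negPf phi0) /= => X; apply/eqP/X.
apply: (sub_finite_set _ (section_finite tL.1)) => z /= Xz; apply: contrapT => /eqP Lz.
apply: Xz; apply: (mulIf Lz); rewrite mul0r mulrBl -mulrA -HB.
by rewrite -[psi _ * _ * _]mulrAC -H; ring.
Qed.

(** * Collinearity of the preimage of a line section *)

Section Collinear.
Variables (z0 : Z) (u v : V) (a b c : 'rV[K]_3) (x : K) (ts : seq K).
Variables (u' v' : V) (a' b' c' : 'rV[K]_3).
Hypothesis fr : frame u v (e (gamma z0)) a b c.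
Hypothesis sec : transversal_section n F (e (gamma z0)) (u + x *: v) ts.
Hypothesis fr' : frame u' v' (e z0) a' b' c'.
Let L := b - x *: a.
Let slope z := lin b' (e z) / lin a' (e z).
Hypothesis good : forall z, z <> z0 -> lin L (e (gamma z)) = 0 ->
  lin a' (e z) != 0 /\
  exists ss, transversal_section n F (e z0) (u' + slope z *: v') ss.

Let tL : transversal L := section_transversal fr sec.

Let Lz0 : lin L (e (gamma z0)) = 0.
Proof. by rewrite section_row; have [-> -> _] := frame_w fr; rewrite mulr0 subrr. Qed.

Lemma finite_slopes (ys : seq K) :
  finite_set [set z | \prod_(s <- ys) lin (b' - s *: a') (e z) = 0].
Proof.
elim: ys => [|s ys IH].
  by apply: (sub_finite_set _ (finite_set0 Z)) => z /eqP; rewrite big_nil oner_eq0.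
have fs : finite_set [set z | lin (b' - s *: a') (e z) = 0].
  apply: (@line_finite _ v'); rewrite section_row; have [-> -> _] := frame_v fr'.
  by rewrite mulr0 subr0 oner_eq0.
apply: (sub_finite_set (B := [set z | lin (b' - s *: a') (e z) = 0] `|`
  [set z | \prod_(s <- ys) lin (b' - s *: a') (e z) = 0])); last by rewrite finite_setU.
by move=> z /= /eqP; rewrite big_cons mulf_eq0 => /orP[/eqP|/eqP]; [left|right].
Qed.

Lemma form_slopes (ys : seq K) :
  form (size ys) (fun p => \prod_(s <- ys) lin (b' - s *: a') p).
Proof.
elim: ys => [|s ys IH].
  rewrite (_ : (fun p => _) = fun=> 1); first exact: form_cst.
  by apply/funext => p; rewrite big_nil.
rewrite (_ : (fun p => _) = fun p => lin (b' - s *: a') p *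
  \prod_(s <- ys) lin (b' - s *: a') p); last by apply/funext => p; rewrite big_cons.
by rewrite -[size _]/(1 + size ys)%N; apply: formM => //; exact: form_lin.
Qed.

(** The lines are divided out one by one; the quotient still vanishes on the others, first away from
    [e z0], then everywhere since a polynomial in [t] is determined off 0. *)
Lemma form_div_slopes (ys : seq K) B : uniq ys -> form (size ys) B ->
  (forall s t, s \in ys -> B (e z0 + t *: (u' + s *: v')) = 0) ->
  exists k, forall p, B p = k * \prod_(s <- ys) lin (b' - s *: a') p.
Proof.
elim: ys B => [|s ys IH] B /=.
  move=> _ hB _; exists (B 0) => p; rewrite big_nil mulr1 -(scale0r p).
  by rewrite (form_homog _ _ hB) expr0 mul1r.
move=> /andP[sys uys] hB B0.
have frs : frame v' (u' + s *: v') (e z0) (b' - s *: a') a' c'.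
  split=> [y|p q r]; rewrite section_row.
    by rewrite {1}(frameE fr' y); apply/colP => i; rewrite !mxE; ring.
  have -> : p *: v' + q *: (u' + s *: v') + r *: e z0 =
      q *: u' + (p + s * q) *: v' + r *: e z0.
    by apply/colP => i; rewrite !mxE; ring.
  by have [-> -> ->] := frame_coord fr' q (p + s * q) r; rewrite addrK.
have vanish (G : V -> K) d y : form d G -> (forall t, t != 0 -> G (e z0 + t *: y) = 0) ->
    G y = 0 /\ forall t, G (e z0 + t *: y) = 0.
  move=> /(form_line (e z0) y)[q [_ qd qE]] G0; suff q0 : q = 0.
    by rewrite -qd q0 coef0; split=> // t; rewrite -qE q0 horner0.
  apply: (poly_cofinite_eq0 (finite_set1 0)) => t /eqP t0.
  by rewrite qE G0.
have [|g hg gE] := form_div_vanish frs hB.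
  have [By Bt] := vanish _ _ _ hB (fun t _ => B0 s t (mem_head _ _)).
  move=> q r; have [->|r0] := eqVneq r 0.
    by rewrite scale0r addr0 (form_homog _ _ hB) By mulr0.
  have -> : q *: (u' + s *: v') + r *: e z0 =
      r *: (e z0 + (q / r) *: (u' + s *: v')).
    by rewrite [RHS]scalerDr scalerA mulrCA divff // mulr1 addrC.
  by rewrite (form_homog _ _ hB) Bt mulr0.
have [|k kE] := IH g uys hg; last first.
  by exists k => p; rewrite gE kE big_cons; ring.
move=> s' t s'ys; have ss' : s' - s != 0.
  by rewrite subr_eq0; apply: contraNneq sys => <-.
have [|_ -> //] := vanish g _ (u' + s' *: v') hg.
move=> r r0; have := B0 s' r; rewrite inE s'ys orbT => /(_ isT)/eqP.
rewrite gE mulf_eq0 section_row; have [-> -> _] := section_point_coord s' fr' r.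
by rewrite [s * _]mulrC -mulrBr mulf_eq0 (negPf r0) (negPf ss') => /eqP.
Qed.

Let wt t := e (gamma z0) + t *: (u + x *: v).

(** Labels the preimage of the section by the roots [t], with 0 standing for [z0]. *)
Lemma section_lift : exists zt : K -> Z,
  [/\ forall t, t \in ts -> t != 0 -> zt t <> z0,
      forall t, t \in ts -> exists2 k, k != 0 & e (gamma (zt t)) = k *: wt t &
      forall z, lin L (e (gamma z)) = 0 -> z <> z0 ->
        exists t, [/\ t \in ts, t != 0 & z = zt t]].
Proof.
have [fy _ _ tsE _] := sec.
have [zeta [kappa zE]] := point_choice z0.
have wE t : t \in ts -> wt t = kappa (wt t) *: e (zeta (wt t)) /\ kappa (wt t) != 0.
  by rewrite tsE => /eqP ft; apply: zE => //; exact: section_point_neq0 fr t.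
have coord t := section_point_coord x fr t.
exists (fun t => delta (zeta (wt t))); split.
- move=> t tts t0 E; have [tE k0] := wE t tts; have [at_ _ _] := coord t.
  move/eqP: t0; apply; rewrite -at_ -/(wt t) tE linZ.
  have -> : zeta (wt t) = gamma z0 by rewrite -E deltaK.
  by have [-> _ _] := frame_w fr; rewrite mulr0.
- move=> t /wE[tE k0]; exists (kappa (wt t))^-1; first by rewrite invr_eq0.
  by rewrite deltaK {3}tE scalerA mulVf // scale1r.
move=> z Lz zz0; have [s [t [s0 tts zE']]] := section_points fr sec Lz.
exists t; split=> //.
  apply/eqP => t0; apply: zz0; apply: (can_inj gammaK); apply: (@e_inj _ _ s).
  by rewrite zE' t0 scale0r addr0.
apply: (can_inj gammaK); rewrite deltaK; have [tE k0] := wE t tts.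
by apply: (@e_inj _ _ (s * kappa (wt t))); rewrite -scalerA -tE.
Qed.

Section Slopes.
Variable zt : K -> Z.
Hypothesis zt_neq : forall t, t \in ts -> t != 0 -> zt t <> z0.
Hypothesis ztE : forall t, t \in ts -> exists2 k, k != 0 & e (gamma (zt t)) = k *: wt t.
Hypothesis zt_surj : forall z, lin L (e (gamma z)) = 0 -> z <> z0 ->
  exists t, [/\ t \in ts, t != 0 & z = zt t].

Let Lzt t : t \in ts -> lin L (e (gamma (zt t))) = 0.
Proof.
move=> /ztE[k _ ->]; rewrite linZ section_row; have [-> -> _] := section_point_coord x fr t.
by rewrite [x * t]mulrC subrr mulr0.
Qed.

Lemma slopes_eq t1 t t' : t1 \in ts -> t1 != 0 ->
  t \in ts -> t != 0 -> t != t1 -> t' \in ts -> t' != 0 -> t' != t1 ->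
  slope (zt t) = slope (zt t').
Proof.
move=> t1ts t10 tts t0 tt1 t'ts t'0 t't1; apply: contrapT => /eqP st.
have [_ uts sts tsE _] := sec.
(* The n - 2 points to be joined to [z0]: 0 is [z0] itself, and [L1] will take care of [t1]. *)
pose ts2 := [seq r <- ts | (r != 0) && (r != t1)].
have ts2P r : (r \in ts2) = [&& r != 0, r != t1 & r \in ts].
  by rewrite mem_filter andbA.
have ts2n : (size ts2).+2 = n.
  have ts0 : 0 \in ts by rewrite tsE scale0r addr0 e_curve.
  rewrite -sts; have -> : ts2 = rem t1 (rem 0 ts).
    rewrite (rem_filter 0 uts) rem_filter ?filter_uniq // -filter_predI.
    by apply: eq_filter => r /=; rewrite andbC.
  have t1r : t1 \in rem 0 ts by rewrite (mem_rem_uniq 0 uts) inE t10.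
  by rewrite (perm_size (perm_to_rem ts0)) /= (perm_size (perm_to_rem t1r)).
pose ys := undup [seq slope (zt r) | r <- ts2].
have uys : uniq ys := undup_uniq _.
have sys r : r \in ts2 -> slope (zt r) \in ys by move=> h; rewrite mem_undup; apply/mapP; exists r.
have ys2 : exists s1 s2 ys', ys = [:: s1, s2 & ys'].
  have h1 : slope (zt t) \in ys by apply: sys; rewrite ts2P t0 tt1.
  have h2 : slope (zt t') \in ys by apply: sys; rewrite ts2P t'0 t't1.
  case: ys h1 h2 {uys sys} => [|s1 [|s2 ys']] //; last by exists s1, s2, ys'.
  by rewrite !inE => /eqP E /eqP E'; rewrite E E' eqxx in st.
pose r := size ys; pose E p := \prod_(s <- ys) lin (b' - s *: a') p.
have hE : form r E := form_slopes ys.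
pose L1 := t1 *: c - a.
have L1E p : lin L1 p = t1 * lin c p - lin a p.
  by rewrite /L1 -scaleN1r linDl !linZl mulN1r.
have L1z0 : lin L1 (e (gamma z0)) = t1.
  by rewrite L1E; have [-> _ ->] := frame_w fr; rewrite mulr1 subr0.
have L1zt : lin L1 (e (gamma (zt t1))) = 0.
  have [k k0 ->] := ztE t1ts; rewrite linZ L1E.
  by have [-> _ ->] := section_point_coord x fr t1; rewrite mulr1 subrr mulr0.
have Ez0 s : lin (b' - s *: a') (e z0) = 0.
  by rewrite section_row; have [-> -> _] := frame_w fr'; rewrite mulr0 subrr.
have Ezt q : q \in ts2 -> E (e (zt q)) = 0.
  move=> qts; apply/eqP; rewrite prodf_seq_eq0; apply/hasP; exists (slope (zt q)).
    exact: sys.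
  move: qts; rewrite ts2P => /and3P[q0 _ qts].
  have [aq _] := good (zt_neq qts q0) (Lzt qts).
  by rewrite /= section_row /slope mulfVK // subrr.
have EL z : lin L (e (gamma z)) = 0 -> E (e z) = 0 \/ lin L1 (e (gamma z)) = 0.
  move=> Lz; have [->|/eqP zz0] := eqVneq z z0.
    left; rewrite /E; have [s1 [s2 [ys' ->]]] := ys2.
    by rewrite big_cons Ez0 mul0r.
  have [q [qts q0 ->]] := zt_surj Lz zz0.
  have [->|qt1] := eqVneq q t1; first by right.
  by left; apply: Ezt; rewrite ts2P q0 qt1.
have [B hB BE] := quotient_form hE tL EL.
(* Two lines of [E] pass through [z0]: one cancels the pole, the other gives the zero. *)
have Bz0 : B (e z0) = 0.
  have [s1 [s2 [ys' ysE]]] := ys2.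
  apply: (@quotient_form_vanish 1 (size (s2 :: ys')) (lin (b' - s1 *: a'))
    (fun p => \prod_(s <- s2 :: ys') lin (b' - s *: a') p) B L1 L z0 tL) => //.
  - exact: form_slopes.
  - by have := hB; rewrite /r ysE.
  - by move=> z; have := BE z; rewrite /E ysE big_cons.
  - by apply: has_quotient_zero => //; exact: form_lin.
  - by rewrite big_cons Ez0 mul0r.
(* [zt t1] may lie on a line of [E]; as [L1 / L] has no pole there, [B] vanishes with [E]. *)
have Bzt : E (e (zt t1)) = 0 -> B (e (zt t1)) = 0.
  move=> E0; apply: (@quotient_form_vanish 0 r (fun=> 1) E B L1 L (zt t1) tL) => //.
  - by move=> z; rewrite mul1r.
  - by apply: has_quotient_common_zero => //; [exact: form_cst|exact: Lzt].
have B0 z : E (e z) = 0 -> z \notin [seq zt q | q <- ts2] -> B (e z) = 0.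
  move=> E0 zN; have [Lz|Lz] := eqVneq (lin L (e (gamma z))) 0; last first.
    by have := BE z; rewrite E0 mul0r => /esym/eqP; rewrite mulf_eq0 (negPf Lz) orbF => /eqP.
  have [->//|/eqP zz0] := eqVneq z z0.
  have [q [qts q0 zq]] := zt_surj Lz zz0.
  have [qt1|qt1] := eqVneq q t1; first by rewrite zq qt1 in E0 *; exact: Bzt.
  by case/negP: zN; rewrite zq map_f // ts2P q0 qt1.
have Bline s q : s \in ys -> B (e z0 + q *: (u' + s *: v')) = 0.
  move=> s_ys.
  have [ss [fy' uss sss ssE _]] : exists ss, transversal_section n F (e z0) (u' + s *: v') ss.
    move: s_ys; rewrite mem_undup => /mapP[q' q'ts ->].
    move: q'ts; rewrite ts2P => /and3P[q'0 _ q'ts].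
    by have [] := good (zt_neq q'ts q'0) (Lzt q'ts).
  have [p [sp _ pE]] := form_line (e z0) (u' + s *: v') hB.
  suff p0 : p = 0 by rewrite -pE p0 horner0.
  have [zeta [kappa zE]] := point_choice z0.
  pose pt q := e z0 + q *: (u' + s *: v').
  have ptE q' : q' \in ss -> pt q' = kappa (pt q') *: e (zeta (pt q')) /\ kappa (pt q') != 0.
    by rewrite ssE => /eqP fq; apply: zE => //; exact: section_point_neq0 fr' q'.
  have coord q' := section_point_coord s fr' q'.
  have zpt_inj : {in ss &, injective (zeta \o pt)}.
    move=> q1 q2 q1s q2s /= E12.
    have [tE k0] := ptE _ q1s; have [tE' k0'] := ptE _ q2s.
    have cE : pt q1 = (kappa (pt q1) / kappa (pt q2)) *: pt q2.
      by rewrite {1}tE {2}tE' scalerA mulfVK // E12.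
    have [at_ _ ct] := coord q1; have [at' _ ct'] := coord q2.
    move: ct at_; rewrite -!/(pt q1) cE !linZ ct' at' mulr1 => ->.
    by rewrite mul1r.
  (* The points of this line where a pole may use up the zero of [E]; they are discarded from the
     count. *)
  pose Zs := [seq zt q' | q' <- [seq q' <- ts2 | slope (zt q') == s]].
  pose bad := [pred q' | zeta (pt q') \in Zs].
  apply: (@roots_geq_poly_eq0 _ _ [seq q' <- ss | ~~ bad q']).
  - apply/allP => q'; rewrite mem_filter => /andP[Nbad q's]; apply/eqP.
    have [qE k0] := ptE _ q's.
    rewrite pE -/(pt q') qE (form_homog _ _ hB) B0 ?mulr0 //.
      apply/eqP; rewrite prodf_seq_eq0; apply/hasP; exists s => //=.
      have : lin (b' - s *: a') (pt q') = 0.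
        rewrite section_row; have [-> -> _] := coord q'.
        by rewrite mulrC subrr.
      by rewrite {1}qE linZ => /eqP; rewrite mulf_eq0 (negPf k0).
    apply: contra Nbad => /mapP[q'' q''ts zq]; rewrite /= zq map_f //.
    rewrite mem_filter q''ts andbT -zq.
    move: q''ts; rewrite ts2P => /and3P[q''0 _ q''ts].
    have [aq _] := good (zt_neq q''ts q''0) (Lzt q''ts); rewrite -zq in aq.
    have [] := coord q'; rewrite -!/(pt q') {1 2}qE !linZ => aE bE _.
    apply/eqP/(mulIf aq); rewrite /slope mulfVK //; apply: (mulfI k0).
    by rewrite bE mulrCA aE mulrC.
  - by rewrite filter_uniq.
  have szbad : (size [seq q' <- ss | bad q'] <= count (fun q' => slope (zt q') == s) ts2)%N.
    have -> : count (fun q' => slope (zt q') == s) ts2 = size Zs.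
      by rewrite size_map size_filter.
    rewrite -(size_map (zeta \o pt)); apply: uniq_leq_size.
      rewrite map_inj_in_uniq ?filter_uniq // => q1 q2.
      by rewrite !mem_filter => /andP[_ h1] /andP[_ h2]; exact: zpt_inj.
    by move=> _ /mapP[q' /[!mem_filter] /andP[h _] ->].
  (* Each slope other than [s] comes from a point off this line. *)
  have szr : (r + count (fun q' => slope (zt q') == s) ts2 <= (size ts2).+1)%N.
    rewrite -(count_predC (fun q' => slope (zt q') == s) ts2) addnC -addnS leq_add2l.
    rewrite /r -[X in (size X <= _)%N]/ys -size_filter -(size_map (slope \o zt)).
    rewrite -[_.+1]/(size (s :: _)); apply: uniq_leq_size => // y.
    rewrite mem_undup inE => /mapP[q' q'ts ->]; have [//|ys_] := eqVneq (slope (zt q')) s.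
    by apply/mapP; exists q' => //; rewrite mem_filter /= ys_.
  apply: (leq_trans sp); rewrite ltnNge; apply/negP => sg.
  have : (n <= count (fun q' => slope (zt q') == s) ts2 + r)%N.
    rewrite -sss -(count_predC bad ss); apply: leq_add; rewrite -size_filter //.
  by rewrite addnC => /leq_trans/(_ szr); rewrite -ts2n ltnn.
have [k kE] := form_div_slopes uys hB Bline.
(* From [B = k E] follows [L1 = k L] off the zeros of [E], hence on the curve; at the image of [z0]
   this reads [t1 = 0]. *)
have : forall z, lin (L1 - k *: L) (e z) = 0.
  apply: (form_vanish_closure (form_lin _)).
  apply: (sub_finite_set _ (finite_image gamma (finite_slopes ys))) => z /= Lz.
  exists (delta z) => //; apply/eqP; apply: contra_notT Lz => Ez.
  apply: (mulfI Ez); have := BE (delta z); rewrite deltaK kE /E => BEz.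
  rewrite mulr0 -scaleNr linDl linZl mulrDr BEz; ring.
move=> /(_ (gamma z0)); rewrite -scaleNr linDl linZl Lz0 L1z0 mulr0 addr0 => t1E.
by rewrite t1E eqxx in t10.
Qed.

End Slopes.

(** As n >= 4, three nonzero parameters exist: any [t] is compared with [t3] by setting aside [t1],
    or [t2] when [t] is [t1]. *)
Lemma preimage_collinear : (3 < n)%N -> exists l, (exists k, lin l k != 0) /\
  forall z, lin L (e (gamma z)) = 0 -> lin l (e z) = 0.
Proof.
move=> n_gt3; have [zt [zt_neq ztE zt_surj]] := section_lift.
have [_ uts sts tsE _] := sec.
have ts0 : 0 \in ts by rewrite tsE scale0r addr0 e_curve.
have [t1 [t2 [t3 [ts' E]]]] : exists t1 t2 t3 ts', rem 0 ts = [:: t1, t2, t3 & ts'].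
  have := perm_size (perm_to_rem ts0); rewrite sts /= => szr; move: n_gt3; rewrite szr.
  by case: (rem 0 ts) => [|t1 [|t2 [|t3 ts']]] // _; exists t1, t2, t3, ts'.
have := rem_uniq 0 uts; rewrite E /= !inE => /and4P[/norP[n12 /norP[n13 _]] /norP[n23 _] _ _].
have memE t : t \in [:: t1, t2, t3 & ts'] -> t \in ts /\ t != 0.
  by rewrite -E (mem_rem_uniq 0 uts) inE => /andP[-> ->].
have [t1ts t10] := memE t1 (mem_head _ _).
have [|t2ts t20] := memE t2; first by rewrite !inE eqxx orbT.
have [|t3ts t30] := memE t3; first by rewrite !inE eqxx !orbT.
have eqs := slopes_eq zt_neq ztE zt_surj.
have all3 t : t \in ts -> t != 0 -> slope (zt t) = slope (zt t3).
  move=> tts t0; have [->|tt1] := eqVneq t t1.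
    by apply: (eqs t2); rewrite // eq_sym.
  by apply: (eqs t1); rewrite // eq_sym.
exists (b' - slope (zt t3) *: a'); split.
  exists v'; rewrite section_row; have [-> -> _] := frame_v fr'.
  by rewrite mulr0 subr0 oner_eq0.
move=> z Lz; rewrite section_row; have [->|/eqP zz0] := eqVneq z z0.
  by have [-> -> _] := frame_w fr'; rewrite mulr0 subrr.
have [t [tts t0 zE]] := zt_surj z Lz zz0.
rewrite -(all3 t tts t0) -zE; have [az _] := good zz0 Lz.
by rewrite /slope mulfVK // subrr.
Qed.

End Collinear.

Lemma slope_finite w u v a b c (S : set Z) : frame u v w a b c -> finite_set S ->
  (forall z s, S z -> e z <> s *: w) ->
  finite_set [set x | exists2 z, S z & lin (b - x *: a) (e z) = 0].
Proof.
move=> fr fS Sw.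
apply: (sub_finite_set _ (finite_image (fun z => lin b (e z) / lin a (e z)) fS)).
move=> x [z Sz /eqP]; rewrite section_row subr_eq0 => /eqP bE; exists z => //.
have a0 : lin a (e z) != 0.
  apply/eqP => a0; apply: (Sw z (lin c (e z)) Sz).
  by rewrite {1}(frameE fr (e z)) bE a0 mulr0 !scale0r !add0r.
by rewrite bE mulfK.
Qed.

Lemma collinear_preimage_exists (z0 : Z) : (3 < n)%N -> exists L l,
  [/\ transversal L, exists k, lin l k != 0 &
   forall z, lin L (e (gamma z)) = 0 -> lin l (e z) = 0].
Proof.
move=> n_gt3.
have [u [v [a [b [c fr]]]]] := frame_ex1 (e_neq0 (gamma z0)).
have [u' [v' [a' [b' [c' fr']]]]] := frame_ex1 (e_neq0 z0).
have fA := transversal_cofinite hF F_smooth n_gt1 fr.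
have fA' := transversal_cofinite hF F_smooth n_gt1 fr'.
pose Y := [set s | ~ exists ss, transversal_section n F (e z0) (u' + s *: v') ss].
(* Points with no slope or on a non-transversal line through [z0]. The point [z0] belongs to [S] but
   lies on every section considered, so only the images of the others are avoided. *)
pose S := [set z | lin a' (e z) = 0] `|`
  \bigcup_(s in Y) [set z | lin (b' - s *: a') (e z) = 0].
have fS : finite_set S.
  rewrite finite_setU; split.
    by apply: (@line_finite _ u'); have [-> _ _] := frame_u fr'; rewrite oner_eq0.
  apply: bigcup_finite => // s _; apply: (@line_finite _ v'); rewrite section_row.
  by have [-> -> _] := frame_v fr'; rewrite mulr0 subr0 oner_eq0.
have fx : finite_set [set x | exists2 y, (gamma @` (S `\` [set z0])) y &
    lin (b - x *: a) (e y) = 0].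
  apply: (slope_finite fr); first by apply/finite_image/finite_setD.
  by move=> _ s [z [_ zz0] <-] /e_inj/(can_inj gammaK).
have [x [/contrapT[ts sec] xS]] := cofinite_ex2 fA fx.
have [|l [l0 lL]] := @preimage_collinear z0 u v a b c x ts u' v' a' b' c' fr sec fr' _ n_gt3.
  move=> z zz0 Lz; have NSz : ~ S z.
    by move=> Sz; apply: xS; exists (gamma z) => //; exists z.
  have az : lin a' (e z) != 0 by apply/eqP => az; apply: NSz; left.
  split=> //; apply: contrapT => NY; apply: NSz; right.
  exists (lin b' (e z) / lin a' (e z)) => //=.
  by rewrite section_row mulfVK // subrr.
by exists (b - x *: a), l; split=> //; apply: section_transversal fr sec.
Qed.

Lemma transversal_avoiding (z0 : Z) (S : set Z) : finite_set S ->
  exists L, transversal L /\ forall z, S z -> lin L (e z) != 0.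
Proof.
move=> fS; have [v [w [a [b [c [fr fw]]]]]] := noncurve_frame z0.
have fA := transversal_cofinite hF F_smooth n_gt1 fr.
have [|x [/contrapT[ts sec] xS]] := cofinite_ex2 fA (slope_finite fr fS _).
  move=> z s _ E; have := e_curve z; have := e_neq0 z.
  rewrite E scaler_eq0 => /norP[s0 _] /eqP.
  by rewrite (form_homog _ _ fF) mulf_eq0 expf_eq0 (negPf s0) (negPf fw) andbF.
exists (b - x *: a); split; first exact: section_transversal fr sec.
by move=> z Sz; apply/eqP => Lz; apply: xS; exists z.
Qed.

Lemma quotient_matrix L l : transversal L ->
  (forall z, lin L (e (gamma z)) = 0 -> lin l (e z) = 0) ->
  exists M : 'M[K]_3, forall z, lin l (e z) *: e (gamma z) = lin L (e (gamma z)) *: (M *m e z).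
Proof.
move=> tL lL.
have /boolp.choice[B BE] : forall j : 'I_3, exists r, forall z,
    lin l (e z) * e (gamma z) j 0 = lin L (e (gamma z)) * lin r (e z).
  move=> j; have [|B hB BE] := @quotient_form 1 (lin l) (delta_mx 0 j) L (form_lin l) tL.
    by move=> z /lL; left.
  have [r rE] := lin_form hB; exists r => z.
  by have := BE z; rewrite lin_delta rE [RHS]mulrC.
exists (\matrix_i B i) => z; apply/colP => j.
by rewrite [LHS]mxE BE [RHS]mxE -lin_row rowK.
Qed.

Theorem automorphism_linear (z0 : Z) : (3 < n)%N -> exists2 M : 'M[K]_3, M \in unitmx &
  forall z, exists k, M *m e z = k *: e (gamma z).
Proof.
move=> n_gt3; have [L [l [tL l0 lL]]] := collinear_preimage_exists z0 n_gt3.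
have [M ME] := quotient_matrix tL lL.
have fL : finite_set [set z | lin L (e z) = 0] by have [[k Lk] _] := tL; exact: line_finite Lk.
(* Where [L] vanishes at the image, [ME] only reads 0 = 0. A line [L'] meeting the curve elsewhere
   covers these points. *)
have [L' [tL' L'0]] := transversal_avoiding z0 fL.
have fl : finite_set [set z | lin l (e z) = 0] by have [k lk] := l0; exact: line_finite lk.
(* The linear form that cuts out the preimage of [L'], as [l] does for [L]. *)
pose lam := L' *m M.
have lamE z : lin l (e z) * lin L' (e (gamma z)) = lin L (e (gamma z)) * lin lam (e z).
  by rewrite -linZ ME linZ /lam /lin mulmxA.
have lamL z : lin L' (e (gamma z)) = 0 -> lin lam (e z) = 0.
  move=> L'z; have Lz : lin L (e (gamma z)) != 0.
    by apply/eqP => Lz; have := L'0 _ Lz; rewrite L'z eqxx.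
  by apply: (mulfI Lz); rewrite -lamE L'z !mulr0.
have [M' ME'] := quotient_matrix tL' lamL.
have MM z : M' *m e z = M *m e z.
  apply/colP => j; apply/eqP; rewrite -subr_eq0; apply/eqP.
  rewrite -!lin_row -mulN1r -linZl -linDl.
  apply: (form_vanish_closure (form_lin _)) z.
  apply: (sub_finite_set (B := [set z | lin l (e z) = 0] `|`
    ([set z | lin L (e (gamma z)) = 0] `|` [set z | lin L' (e (gamma z)) = 0]))); last first.
    rewrite !finite_setU; split=> //; split; apply: section_finite.
      by case: tL.
    by case: tL'.
  move=> z /= Nz; apply: contrapT => /not_orP[/eqP lz /not_orP[/eqP Lz /eqP L'z]].
  apply: Nz; rewrite linDl linZl mulN1r !lin_row; apply/eqP; rewrite subr_eq0; apply/eqP.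
  suff -> : M' *m e z = M *m e z by [].
  apply: (scalerI (mulf_neq0 lz L'z)).
  by rewrite -scalerA -ME' scalerA mulrC -scalerA ME scalerA mulrC -lamE.
(* A row killing [M] vanishes at almost all points of the curve, which spans the plane. *)
have Munit : M \in unitmx.
  rewrite unitmxE unitfE; apply/det0P => -[r r0 rM].
  have [k rk] : exists k, lin r k != 0.
    have [j rj] := rV0Pn _ r0; exists (delta_mx j 0).
    by rewrite /lin -colE mxE.
  move/eqP: rk; apply; apply: curve_spans z0 _ k.
  apply: (form_vanish_closure (form_lin _)).
  apply: (sub_finite_set _ (finite_image gamma fl)) => z /= rz.
  exists (delta z) => //; apply: contrapT => /eqP lz; apply: rz.
  have rM0 y : lin r (M *m y) = 0 by rewrite /lin mulmxA rM mul0mx mxE.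
  by apply: (mulfI lz); rewrite mulr0 -linZ -{2}[z]deltaK ME linZ rM0 mulr0.
exists M => // z; have [Lz|Lz] := eqVneq (lin L (e (gamma z))) 0.
  have L'z := L'0 _ Lz; exists (lin lam (e z) / lin L' (e (gamma z))).
  by rewrite mulrC -scalerA ME' scalerA mulVf // scale1r MM.
exists (lin l (e z) / lin L (e (gamma z))).
by rewrite mulrC -scalerA ME scalerA mulVf // scale1r.
Qed.

End Automorphism.

End Curve.

(** * Morphisms of spaces with functions *)

Section ProjectivePoints.
Variable K : fieldType.
Local Notation V := 'cV[K]_3.
Local Notation P2 := (proj_space K 2).

Definition rep (p : P2) : V := vpick (val p).

Lemma rep_mem p : rep p \in val p.
Proof. exact: memv_pick. Qed.

Lemma rep_neq0 p : rep p != 0.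
Proof. by rewrite vpick0 -dimv_eq0; case: p => L /= /eqP ->. Qed.

Lemma proj_span (p : P2) v : v \in val p -> v != 0 -> val p = <[v]>%VS.
Proof.
move=> vp v0; apply/esym/eqP; rewrite eqEdim -memvE vp /= dim_vline v0.
by case: p {vp} => L /= /eqP ->.
Qed.

Lemma proj_eq (p q : P2) v : v \in val p -> v \in val q -> v != 0 -> p = q.
Proof. by move=> vp vq v0; apply: val_inj; rewrite (proj_span vp v0) (proj_span vq v0). Qed.

Lemma proj_point (v : V) : v != 0 -> exists p : P2, v \in val p.
Proof.
move=> v0; have dv : \dim <[v]> == 1%N by rewrite dim_vline v0.
by exists (Sub <[v]>%VS dv); rewrite SubK memv_line.
Qed.

Lemma rep_nvanish d (G : {mpoly K[3]}) p : G \is d.-homog ->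
  ~ vanishes_at G p <-> mpeval G (rep p) != 0.
Proof.
move=> hG; split=> [/(nvanishP _ hG)|Gp].
  by apply; [exact: rep_mem|exact: rep_neq0].
by move=> /(_ _ (rep_mem p)) /eqP; rewrite (negPf Gp).
Qed.

Lemma open_nvanish d (G : {mpoly K[3]}) : G \is d.-homog ->
  open [set p : P2 | ~ vanishes_at G p].
Proof.
move=> hG; change (zariski_open [set p : P2 | ~ vanishes_at G p]).
by apply/zariski_openP => p nG; exists d, G.
Qed.

Lemma regular_quotient d (A B : {mpoly K[3]}) : A \is d.-homog -> B \is d.-homog ->
  regular [set p : P2 | ~ vanishes_at B p]
    (fun p => mpeval A (rep p) / mpeval B (rep p)).
Proof.
move=> hA hB p nB; exists d, A, B, [set p : P2 | ~ vanishes_at B p]; split.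
  by split=> //; exact: open_nvanish hB.
move=> q v nBq vq v0; have [c cE] := proj_line vq (rep_mem q) v0.
have c0 : c != 0 by apply: contraNneq (rep_neq0 q) => c0; rewrite cE c0 scale0r.
split; first exact: ((nvanishP _ hB).1 nBq).
by rewrite cE (mpevalZ _ _ hA) (mpevalZ _ _ hB) -mulf_div divff ?mul1r // expf_neq0.
Qed.

Lemma proj_change_exists (g : 'M[K]_3) : g \in unitmx ->
  exists psi : P2 -> P2, forall p, val (psi p) = (linfun (mulmx g) @: val p)%VS.
Proof.
move=> gU.
have dimg (p : P2) : \dim (linfun (mulmx g) @: val p)%VS == 1%N.
  rewrite limg_dim_eq; first by case: p.
  apply/eqP; rewrite -subv0; apply/subvP => v.
  rewrite memv_cap memv_ker lfunE /= memv0 => /andP[_ /eqP gv].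
  by rewrite -[v]mul1mx -(mulVmx gU) -mulmxA gv mulmx0.
by exists (fun p => exist (fun L : {vspace V} => \dim L == 1%N) _ (dimg p)).
Qed.

End ProjectivePoints.

Section ClosedImmersions.
Variables (K : numClosedFieldType) (Z : funSpaceType K) (i : Z -> proj_space K 2).
Hypothesis i_immersion : is_closed_immersion i.

(** A pulled-back quotient is regular on [Z]; the closed immersion extends it locally to the plane,
    where it is again a quotient of forms. *)
Lemma morphism_pulls_back mu : is_morphism mu -> pulls_back (fun z => rep (i z)) mu.
Proof.
move=> [mu_cont mu_reg] d A B z0 [GA hA AE] [GB hB BE] /= Bz0.
have [[i_cont i_reg] _ _ i_surj] := i_immersion.
pose U := [set p : proj_space K 2 | ~ vanishes_at GB p].
have oU : open U := open_nvanish hB.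
have oiU : open (i @^-1` U) by move/continuousP : i_cont; apply.
have omU : open (mu @^-1` (i @^-1` U)) by move/continuousP : mu_cont; apply.
have regf := mu_reg _ _ oiU (i_reg _ _ oU (regular_quotient hA hB)).
have Uz0 : (mu @^-1` (i @^-1` U)) z0 by apply/(rep_nvanish _ hB); rewrite -BE.
have [W [g [oW Wz0 WU regg gE]]] := i_surj _ _ _ omU regf Uz0.
have [d1 [G [H [W1 [[hG hH oW1 W1z0 W1W] W1E]]]]] := regg _ Wz0.
have [d2 [Q [hQ nQ QW]]] := (zariski_openP W1).1 oW1 _ W1z0.
(* The factor [Q] confines the locus [phi != 0] to [W1], where [G / H] is valid. *)
exists (d1 + d2)%N, (fun p => mpeval H p * mpeval Q p), (fun p => mpeval G p * mpeval Q p).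
split.
- by apply: formM; exact: form_mpeval.
- by apply: formM; exact: form_mpeval.
- have [H0 _] := W1E _ _ W1z0 (rep_mem _) (rep_neq0 _).
  by rewrite mulf_neq0 //; apply/(rep_nvanish _ hQ).
move=> z /=; rewrite mulf_eq0 => /norP[Hz Qz].
have W1z : W1 (i z) by apply/QW/(rep_nvanish _ hQ).
have [_ gz] := W1E _ _ W1z (rep_mem _) (rep_neq0 _).
have Wz := W1W _ W1z.
have Bz : B (rep (i (mu z))) != 0.
  by rewrite BE; apply/(rep_nvanish _ hB); exact: WU.
split=> //; have := gE z Wz; rewrite gz /= -AE -BE => E.
have -> : A (rep (i (mu z))) = B (rep (i (mu z))) *
    (mpeval G (rep (i z)) / mpeval H (rep (i z))).
  by rewrite -E mulrC divfK.
by field.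
Qed.

End ClosedImmersions.

Theorem theorem3p19 (R : realType) (n : nat) (hn : (4 <= n)%N)
    (Z : funSpaceType R[i]%C) (i : Z -> proj_space R[i]%C 2)
    (hi : embeds_as_smooth_plane_curve n i)
    (gamma : Z -> Z) (hgamma : is_automorphism gamma) :
  exists psi : proj_space R[i]%C 2 -> proj_space R[i]%C 2,
    is_proj_change psi /\ psi \o i = i \o gamma.
Proof.
have [i_imm [F [_ hF F_smooth rangeE]]] := hi.
have [[z0]|NZ] := EM (exists z0 : Z, True); last first.
  (* Without a point to start from, the identity serves. *)
  have [psi psiE] := proj_change_exists (unitmx1 R[i]%C 3).
  exists psi; split; first by exists 1%:M; rewrite ?unitmx1.
  by apply/funext => z; exfalso; apply: NZ; exists z.
move=> _; have [gamma_mor [delta [delta_mor gammaK deltaK]]] := hgamma.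
have [_ i_inj _ _] := i_imm.
have F_smooth' v : v != 0 -> mpeval F v = 0 -> exists y, dir_deriv F v y != 0.
  move=> v0 /(F_smooth v v0)[j Fj]; exists (delta_mx j 0).
  rewrite /dir_deriv (bigD1 j) //= big1 ?addr0 => [|k /negPf kj].
    by rewrite mxE !eqxx mul1r.
  by rewrite mxE kj mul0r.
have e_curve z : mpeval F (rep (i z)) = 0.
  by have : range i (i z) by [exists z]; rewrite rangeE; apply; exact: rep_mem.
have e_inj z z' c : rep (i z) = c *: rep (i z') -> z = z'.
  move=> E; apply: i_inj; apply: (@proj_eq _ _ _ (rep (i z))); rewrite ?rep_mem ?rep_neq0 //.
  by rewrite E memvZ ?rep_mem.
have e_surj v : v != 0 -> mpeval F v = 0 -> exists z c, v = c *: rep (i z).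
  move=> v0 Fv; have [p vp] := proj_point v0.
  have : range i p.
    rewrite rangeE => w wp; have [c ->] := proj_line vp wp v0.
    by rewrite (mpevalZ _ _ hF) Fv mulr0.
  move=> [z _ zp]; exists z; apply: (proj_line (rep_mem _) _ (rep_neq0 _)).
  by rewrite zp.
have [M MU ME] := automorphism_linear hF F_smooth' (ltnW (ltnW hn))
  (fun z => rep_neq0 (i z)) e_curve e_inj e_surj gammaK deltaK
  (morphism_pulls_back i_imm gamma_mor) (morphism_pulls_back i_imm delta_mor) z0 hn.
have [psi psiE] := proj_change_exists MU.
exists psi; split; first by exists M.
apply/funext => z /=; apply: (@proj_eq _ _ _ (M *m rep (i z))).
- rewrite psiE -[M *m _]/(mulmx M _) -[mulmx M _](lfunE (mulmx M)).
  exact: memv_img (rep_mem _).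
- by have [k ->] := ME z; rewrite memvZ ?rep_mem.
- apply: contraNneq (rep_neq0 (i z)) => M0.
  by rewrite -[rep _]mul1mx -(mulVmx MU) -mulmxA M0 mulmx0.
Qed.
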